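(* Let $H$ be a coquasi-Hopf algebra, $A$ a right $H$-comodule algebra and $B=A^{coH}$. Then $$\mathbb{M}(A)=(Hom^H(\overline{H},A),\,Hom(H,B),\,Hom^H(H,A),\,Hom^H(H^S,A),\,(-,-),\,[-,-])$$ is a Morita context, with connecting morphisms $$(-,-):Hom^H(H,A)\otimes_{Hom^H(\overline{H},A)}Hom^H(H^S,A)\to Hom(H,B),\quad(\mathfrak{p},\mathfrak{q})(h)=\mathfrak{p}(h_1)\beta(h_2)\mathfrak{q}(h_3),$$ $$[-,-]:Hom^H(H^S,A)\otimes_{Hom(H,B)}Hom^H(H,A)\to Hom^H(\overline{H},A),\quad[\mathfrak{q},\mathfrak{p}](h)=\mathfrak{q}(h_1)\mathfrak{p}(h_2).$$
   Context: All vector spaces, algebras and tensor products are over a fixed field $\Bbbk$; Sweedler notation is used: $\Delta(h)=h_1\otimes h_2$, $\rho(a)=a_0\otimes a_1$. Coquasi-bialgebra: a coassociative counital coalgebra $(H,\Delta,\varepsilon)$ with coalgebra morphisms $m:H\otimes H\to H$ (written $h\otimes g\mapsto hg$) and $u:\Bbbk\to H$ (with $u(1)=1_H$), and a convolution invertible $\omega\in(H\otimes H\otimes H)^*$ such that for all $h,g,k,l\in H$: $h_1(g_1k_1)\omega(h_2,g_2,k_2)=\omega(h_1,g_1,k_1)(h_2g_2)k_2$; $1_Hh=h1_H=h$; $\omega(h_1,g_1,k_1l_1)\omega(h_2g_2,k_2,l_2)=\omega(g_1,k_1,l_1)\omega(h_1,g_2k_2,l_2)\omega(h_2,g_3,k_3)$;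 $\omega(h,1_H,g)=\varepsilon(h)\varepsilon(g)$. Coquasi-Hopf algebra: a coquasi-bialgebra $H$ with a coalgebra antihomomorphism $S:H\to H$ and $\alpha,\beta\in H^*$ such that $S(h_1)\alpha(h_2)h_3=\alpha(h)1_H$, $h_1\beta(h_2)S(h_3)=\beta(h)1_H$, and $\omega(h_1,S(h_3),h_5)\beta(h_2)\alpha(h_4)=\omega^{-1}(S(h_1),h_3,S(h_5))\alpha(h_2)\beta(h_4)=\varepsilon(h)$ for all $h\in H$. One assumes, after rescaling, $\alpha(1_H)=\beta(1_H)=1$. Right $H$-comodule algebra: a right $H$-comodule $(A,\rho_A)$ with an $H$-colinear multiplication ($\rho_A(ab)=a_0b_0\otimes a_1b_1$) and an $H$-colinear two-sided unit $1_A$, such that $(ab)c=a_0(b_0c_0)\,\omega(a_1,b_1,c_1)$. $A^{coH}=\{a\in A:\rho_A(a)=a\otimes 1_H\}$ is an associative unital algebra. Rings and bimodules: - $Hom^H(\overline{H},A)$: linear maps $\mathfrak{s}:H\to A$ with $\rho_A(\mathfrak{s}(h))=\mathfrak{s}(h_2)\otimes S(h_1)h_3$; an associative algebra with product $(\mathfrak{s}\ast\mathfrak{t})(h)=\mathfrak{s}(h_3)\mathfrak{t}(h_9)\,\omega(S(h_2)h_4,S(h_8),h_{10})\,\beta(h_6)\,\omega^{-1}(S(h_1),h_5,S(h_7))$ and unit $\alpha 1_A$. - $Hom(H,B)$: linear maps, an algebra under convolution $(\mathfrak{r}\mathfrak{r}')(h)=\mathfrak{r}(h_1)\mathfrak{r}'(h_2)$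 with unit $\varepsilon 1_A$. - $Hom^H(H,A)$: linear maps $\mathfrak{p}$ with $\rho_A(\mathfrak{p}(h))=\mathfrak{p}(h_1)\otimes h_2$; a $(Hom(H,B),Hom^H(\overline{H},A))$-bimodule via $(\mathfrak{rp})(h)=\mathfrak{r}(h_1)\mathfrak{p}(h_2)$, $(\mathfrak{ps})(h)=\mathfrak{p}(h_1)\mathfrak{s}(h_5)\beta(h_3)\omega(h_2,S(h_4),h_6)$. - $Hom^H(H^S,A)$: linear maps $\mathfrak{q}$ with $\rho_A(\mathfrak{q}(h))=\mathfrak{q}(h_2)\otimes S(h_1)$; a $(Hom^H(\overline{H},A),Hom(H,B))$-bimodule via $(\mathfrak{sq})(h)=\mathfrak{s}(h_2)\mathfrak{q}(h_6)\beta(h_4)\omega^{-1}(S(h_1),h_3,S(h_5))$, $(\mathfrak{qr})(h)=\mathfrak{q}(h_1)\mathfrak{r}(h_2)$. Morita context means: the connecting maps are well-defined (balanced) bimodule morphisms and satisfy $(\mathfrak{p},\mathfrak{q})\overline{\mathfrak{p}}=\mathfrak{p}[\mathfrak{q},\overline{\mathfrak{p}}]$ and $[\mathfrak{q},\mathfrak{p}]\overline{\mathfrak{q}}=\mathfrak{q}(\mathfrak{p},\overline{\mathfrak{q}})$ for all $\mathfrak{p},\overline{\mathfrak{p}}\in Hom^H(H,A)$, $\mathfrak{q},\overline{\mathfrak{q}}\in Hom^H(H^S,A)$. *)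

(* Defs.v *)
From HB Require Import structures.
From mathcomp Require Import all_boot all_algebra.
From mathcomp Require Import boolp classical_sets functions.

Set Implicit Arguments.
Unset Strict Implicit.
Unset Printing Implicit Defensive.

Import GRing.Theory.
Local Open Scope ring_scope.
Local Open Scope quotient_scope.

Section Tensor.
Variables (k : fieldType) (V W : lmodType k).
Implicit Types (s t : seq (V * W)) (v : V) (w : W).

(* The tensor product is the quotient of the lists of pairs, a list standing for
   the formal sum of its entries, by the bilinearity relations. *)
Inductive tensor_eq : seq (V * W) -> seq (V * W) -> Prop :=
| tensor_eq_refl s : tensor_eq s s
| tensor_eq_sym s t : tensor_eq s t -> tensor_eq t s
| tensor_eq_trans s t u : tensor_eq s t -> tensor_eq t u -> tensor_eq s u
| tensor_eq_cat s s' t t' :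
    tensor_eq s s' -> tensor_eq t t' -> tensor_eq (s ++ t) (s' ++ t')
| tensor_eq_catC s t : tensor_eq (s ++ t) (t ++ s)
| tensor_eq_0 w : tensor_eq [:: (0, w)] [::]
| tensor_eq_addl v v' w :
    tensor_eq [:: (v + v', w)] [:: (v, w); (v', w)]
| tensor_eq_addr v w w' :
    tensor_eq [:: (v, w + w')] [:: (v, w); (v, w')]
| tensor_eq_scale (a : k) v w : tensor_eq [:: (a *: v, w)] [:: (v, a *: w)].

Definition tensor_eqb s t : bool := `[< tensor_eq s t >].

Lemma tensor_eqb_equiv : equiv_class_of tensor_eqb.
Proof.
split=> [s|s t|t s u].
- by apply/asboolP; apply: tensor_eq_refl.
- by apply/asboolP/asboolP; apply: tensor_eq_sym.
- by move=> /asboolP st /asboolP tu; apply/asboolP; apply: tensor_eq_trans tu.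
Qed.

Canonical tensor_equiv := EquivRelPack tensor_eqb_equiv.

Definition tensor := {eq_quot tensor_equiv}.
HB.instance Definition _ : EqQuotient _ tensor_equiv tensor :=
  EqQuotient.on tensor.
HB.instance Definition _ := Choice.on tensor.

Definition pure v w : tensor := \pi_tensor [:: (v, w)].

Let tensor_add (x y : tensor) : tensor := \pi_tensor (repr x ++ repr y).
Let tensor_scale (a : k) (x : tensor) : tensor :=
  \pi_tensor [seq (a *: p.1, p.2) | p <- repr x].

Lemma tensor_piP s t : tensor_eq s t <-> \pi_tensor s = \pi_tensor t.
Proof.
split=> [st|/eqP]; first by apply/eqP; rewrite eqmodE; apply/asboolP.
by rewrite eqmodE => /asboolP.
Qed.

Lemma tensor_reprP s : tensor_eq (repr (\pi_tensor s)) s.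
Proof. by apply/tensor_piP; rewrite reprK. Qed.

Let add_pi s t : tensor_add (\pi s) (\pi t) = \pi_tensor (s ++ t).
Proof. by apply/tensor_piP; apply: tensor_eq_cat; apply: tensor_reprP. Qed.

Let scale_eq a s t : tensor_eq s t ->
  tensor_eq [seq (a *: p.1, p.2) | p <- s] [seq (a *: p.1, p.2) | p <- t].
Proof.
elim=> /= {s t}.
- by move=> s; apply: tensor_eq_refl.
- by move=> s t _; apply: tensor_eq_sym.
- by move=> s t u _ st _; apply: tensor_eq_trans.
- by move=> s s' t t' _ ss' _ tt'; rewrite !map_cat; apply: tensor_eq_cat.
- by move=> s t; rewrite !map_cat; apply: tensor_eq_catC.
- by move=> w; rewrite scaler0; apply: tensor_eq_0.
- by move=> v v' w; rewrite scalerDr; apply: tensor_eq_addl.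
- by move=> v w w'; apply: tensor_eq_addr.
- by move=> b v w; rewrite scalerA mulrC -scalerA; apply: tensor_eq_scale.
Qed.

Let scale_pi a s :
  tensor_scale a (\pi s) = \pi_tensor [seq (a *: p.1, p.2) | p <- s].
Proof. by apply/tensor_piP; apply: scale_eq; apply: tensor_reprP. Qed.

Let tensor_addA : associative tensor_add.
Proof.
by elim/quotW=> s; elim/quotW=> t; elim/quotW=> u; rewrite !add_pi catA.
Qed.

Let tensor_addC : commutative tensor_add.
Proof.
elim/quotW=> s; elim/quotW=> t; rewrite !add_pi.
by apply/tensor_piP; apply: tensor_eq_catC.
Qed.

Let tensor_add0 : left_id (\pi_tensor [::]) tensor_add.
Proof. by elim/quotW=> s; rewrite add_pi. Qed.

Let tensor_addN :
  left_inverse (\pi_tensor [::]) (tensor_scale (-1)) tensor_add.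
Proof.
elim/quotW=> s; rewrite scale_pi add_pi; apply/tensor_piP.
elim: s => [|[v w] s IHs] /=; first exact: tensor_eq_refl.
set s' := map _ s in IHs *.
apply: (@tensor_eq_trans _ ([:: (-1 *: v, w); (v, w)] ++ (s' ++ s))).
  rewrite -cat_rcons -cats1 /=.
  apply: (@tensor_eq_cat [:: _] [:: _]); first exact: tensor_eq_refl.
  apply: (@tensor_eq_cat _ ([:: _] ++ _)); last exact: tensor_eq_refl.
  exact: tensor_eq_catC.
apply: (@tensor_eq_trans _ ([::] ++ [::])); last exact: tensor_eq_refl.
apply: tensor_eq_cat IHs.
apply: tensor_eq_trans (tensor_eq_0 w).
rewrite -(addNr v) -scaleN1r; apply: tensor_eq_sym; exact: tensor_eq_addl.
Qed.

HB.instance Definition _ := GRing.isZmodule.Build tensor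
  tensor_addA tensor_addC tensor_add0 tensor_addN.

Let tensor_scaleA a b x :
  tensor_scale a (tensor_scale b x) = tensor_scale (a * b) x.
Proof.
elim/quotW: x => s; rewrite !scale_pi -map_comp; congr (\pi _).
by apply: eq_map => p /=; rewrite scalerA.
Qed.

Let tensor_scale1 : left_id 1 tensor_scale.
Proof.
elim/quotW=> s; rewrite scale_pi; congr (\pi _).
by rewrite -[RHS]map_id; apply: eq_map => -[v w]; rewrite scale1r.
Qed.

Let tensor_scaleDr : right_distributive tensor_scale +%R.
Proof.
move=> a; elim/quotW=> s; elim/quotW=> t.
by rewrite /GRing.add /= add_pi !scale_pi add_pi map_cat.
Qed.

Let tensor_scaleDl x : {morph tensor_scale^~ x : a b / a + b}.
Proof.
move=> a b; elim/quotW: x => s; rewrite /= /GRing.add /= !scale_pi add_pi.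
apply/tensor_piP; elim: s => [|[v w] s IHs] /=; first exact: tensor_eq_refl.
apply: (@tensor_eq_trans _ ([:: (a *: v, w); (b *: v, w)] ++ _)).
  apply: (@tensor_eq_cat [:: _] _ _ _ _ IHs).
  by rewrite [_ *: v]scalerDl; apply: tensor_eq_addl.
apply: (@tensor_eq_cat [:: _] [:: _]); first exact: tensor_eq_refl.
set sa := map _ s; set sb := map _ s.
rewrite -[X in tensor_eq _ X](@cat_rcons _ (b *: v, w) sa sb) -cats1.
apply: (@tensor_eq_cat ([:: _] ++ _)); last exact: tensor_eq_refl.
exact: tensor_eq_catC.
Qed.

HB.instance Definition _ := GRing.Zmodule_isLmodule.Build k tensor
  tensor_scaleA tensor_scale1 tensor_scaleDr tensor_scaleDl.

Let pi_cat s t : \pi_tensor (s ++ t) = \pi_tensor s + \pi_tensor t.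
Proof. by rewrite -add_pi. Qed.

Let pi_scale a s :
  \pi_tensor [seq (a *: p.1, p.2) | p <- s] = a *: \pi_tensor s.
Proof. by rewrite -scale_pi. Qed.

Lemma tensor_piE s : \pi_tensor s = \sum_(p <- s) pure p.1 p.2.
Proof.
elim: s => [|[v w] s IHs]; first by rewrite big_nil.
by rewrite big_cons -IHs /pure -pi_cat.
Qed.

Lemma tensor_reprE (t : tensor) : t = \sum_(p <- repr t) pure p.1 p.2.
Proof. by rewrite -tensor_piE reprK. Qed.

Lemma pureDl v v' w : pure (v + v') w = pure v w + pure v' w.
Proof.
rewrite /pure -pi_cat.
by apply/tensor_piP; apply: tensor_eq_addl.
Qed.

Lemma pureDr v w w' : pure v (w + w') = pure v w + pure v w'.
Proof.
rewrite /pure -pi_cat.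
by apply/tensor_piP; apply: tensor_eq_addr.
Qed.

Lemma pureZl a v w : pure (a *: v) w = a *: pure v w.
Proof. by rewrite /pure -pi_scale. Qed.

Lemma pureZr a v w : pure v (a *: w) = a *: pure v w.
Proof.
rewrite -pureZl; apply/tensor_piP.
by apply: tensor_eq_sym; apply: tensor_eq_scale.
Qed.

(* tfold f (\sum_i v_i ⊗ w_i) is \sum_i f v_i w_i; this does not depend on the
   chosen representative as soon as f is bilinear, see tfold_pi. *)
Definition tfold (U : nmodType) (f : V -> W -> U) (t : tensor) : U :=
  \sum_(p <- repr t) f p.1 p.2.

Section Universal.
Variables (U : lmodType k) (f : V -> W -> U).
Hypotheses (fl : forall w, linear (f^~ w)) (fr : forall v, linear (f v)).

Lemma tensor_eq_fold s t : tensor_eq s t ->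
  \sum_(p <- s) f p.1 p.2 = \sum_(p <- t) f p.1 p.2.
Proof.
have f0 w : f 0 w = 0.
  by have /= := fl w (-1) 0 0; rewrite scaler0 addr0 scaleN1r addNr.
have f0r v : f v 0 = 0.
  by have /= := fr v (-1) 0 0; rewrite scaler0 addr0 scaleN1r addNr.
elim=> {s t}.
- by [].
- by move=> s t _ ->.
- by move=> s t u _ -> _.
- by move=> s s' t t' _ ss' _ tt'; rewrite !big_cat /= ss' tt'.
- by move=> s t; rewrite !big_cat /= addrC.
- by move=> w; rewrite big_seq1 big_nil f0.
- move=> v v' w; rewrite big_seq1 big_cons big_seq1 /=.
  by have /= := fl w 1 v v'; rewrite !scale1r.
- move=> v w w'; rewrite big_seq1 big_cons big_seq1 /=.
  by have /= := fr v 1 w w'; rewrite !scale1r.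
- move=> a v w; rewrite !big_seq1 /=.
  by have /= := fl w a v 0; have /= := fr v a w 0; rewrite !addr0 f0 f0r !addr0 => -> ->.
Qed.

Lemma tfold_pi s : tfold f (\pi_tensor s) = \sum_(p <- s) f p.1 p.2.
Proof. by apply: tensor_eq_fold; apply: tensor_reprP. Qed.

Lemma tfold_pure v w : tfold f (pure v w) = f v w.
Proof. by rewrite tfold_pi big_seq1. Qed.

Lemma tfold_linear : linear (tfold f).
Proof.
have fZ a v w : f (a *: v) w = a *: f v w.
  have f0 : f 0 w = 0.
    by have /= := fl w (-1) 0 0; rewrite scaler0 addr0 scaleN1r addNr.
  by have /= := fl w a v 0; rewrite f0 !addr0.
move=> a; elim/quotW=> s; elim/quotW=> t.
rewrite -pi_scale -pi_cat !tfold_pi.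
rewrite big_cat big_map scaler_sumr; congr (_ + _).
by apply: eq_bigr => p _; rewrite fZ.
Qed.

End Universal.
End Tensor.

Notation "V ⊗ W" := (tensor V W) (at level 40, left associativity) : type_scope.
Notation "v ⊗ w" := (pure v w) (at level 40, left associativity) : ring_scope.

Record coalgebra (k : fieldType) := Coalgebra {
  coalg_sort :> lmodType k;
  comul : {linear coalg_sort -> (coalg_sort ⊗ coalg_sort)%type};
  counit : {scalar coalg_sort};
  comulA : forall h : coalg_sort,
    tfold (fun h1 h2 => h1 ⊗ comul h2) (comul h) =
    tfold (fun h1 h2 => tfold (fun h11 h12 => h11 ⊗ (h12 ⊗ h2)) (comul h1))
      (comul h);
  counitl : forall h : coalg_sort,
    tfold (fun h1 h2 => counit h1 *: h2) (comul h) = h;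
  counitr : forall h : coalg_sort,
    tfold (fun h1 h2 => counit h2 *: h1) (comul h) = h
}.

Section Sweedler.
Variables (k : fieldType) (H : coalgebra k) (U : nmodType).

Fixpoint legs (n : nat) : Type := if n is n'.+1 then H -> legs n' else U.

(* sweedler n h (fun h_1 ... h_{n+1} => E) is the value of the (multilinear)
   expression E in Sweedler notation, the legs being those of the n-fold
   iterated coproduct of h. *)
Fixpoint sweedler (n : nat) (h : H) : legs n.+1 -> U :=
  match n return legs n.+1 -> U with
  | 0 => fun f => f h
  | n'.+1 => fun f => tfold (fun h1 h' => sweedler h' (f h1)) (comul H h)
  end.
End Sweedler.

Arguments sweedler {k H U} n h f.

Record coquasi_data (k : fieldType) := CoquasiData {
  cq_coalg :> coalgebra k;
  cq_mul : {linear (cq_coalg ⊗ cq_coalg)%type -> cq_coalg};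
  cq_one : cq_coalg;
  cq_omega : {scalar (cq_coalg ⊗ cq_coalg ⊗ cq_coalg)%type};
  cq_omega_inv : {scalar (cq_coalg ⊗ cq_coalg ⊗ cq_coalg)%type};
  antipode : {linear cq_coalg -> cq_coalg};
  alpha : {scalar cq_coalg};
  beta : {scalar cq_coalg}
}.

Section CoquasiAxioms.
Variables (k : fieldType) (H : coquasi_data k).

(* By the universal property, the morphisms m and omega are used through their
   values on pure tensors. *)
Definition hmul (h g : H) : H := cq_mul H (h ⊗ g).
Definition omega (h g l : H) : k := cq_omega H (h ⊗ g ⊗ l).
Definition omega_inv (h g l : H) : k := cq_omega_inv H (h ⊗ g ⊗ l).

Local Notation "h ∙ g" := (hmul h g) (at level 40, left associativity).
Local Notation "'1H'" := (cq_one H).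
Local Notation Δ := (comul H).
Local Notation ε := (counit H).
Local Notation ω := omega.
Local Notation ω' := omega_inv.
Local Notation S := (antipode H).
Local Notation α := (alpha H).
Local Notation β := (beta H).

Record coquasi_bialgebra_axioms : Prop := {
  cq_mul_comul : forall h g : H,
    Δ (h ∙ g) =
    sweedler 1 h (fun h1 h2 => sweedler 1 g (fun g1 g2 =>
      (h1 ∙ g1) ⊗ (h2 ∙ g2)));
  cq_mul_counit : forall h g : H, ε (h ∙ g) = ε h * ε g;
  cq_one_comul : Δ 1H = 1H ⊗ 1H;
  cq_one_counit : ε 1H = 1;
  cq_omegaV : forall h g l : H,
    sweedler 1 h (fun h1 h2 => sweedler 1 g (fun g1 g2 =>
      sweedler 1 l (fun l1 l2 => ω h1 g1 l1 * ω' h2 g2 l2))) =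
    ε h * ε g * ε l;
  cq_omegaVl : forall h g l : H,
    sweedler 1 h (fun h1 h2 => sweedler 1 g (fun g1 g2 =>
      sweedler 1 l (fun l1 l2 => ω' h1 g1 l1 * ω h2 g2 l2))) =
    ε h * ε g * ε l;
  cq_mulA : forall h g l : H,
    sweedler 1 h (fun h1 h2 => sweedler 1 g (fun g1 g2 =>
      sweedler 1 l (fun l1 l2 => ω h2 g2 l2 *: (h1 ∙ (g1 ∙ l1))))) =
    sweedler 1 h (fun h1 h2 => sweedler 1 g (fun g1 g2 =>
      sweedler 1 l (fun l1 l2 => ω h1 g1 l1 *: ((h2 ∙ g2) ∙ l2))));
  cq_mul1l : forall h : H, 1H ∙ h = h;
  cq_mul1r : forall h : H, h ∙ 1H = h;
  cq_cocycle : forall h g l m : H,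
    sweedler 1 h (fun h1 h2 => sweedler 1 g (fun g1 g2 =>
      sweedler 1 l (fun l1 l2 => sweedler 1 m (fun m1 m2 =>
        ω h1 g1 (l1 ∙ m1) * ω (h2 ∙ g2) l2 m2)))) =
    sweedler 1 h (fun h1 h2 => sweedler 2 g (fun g1 g2 g3 =>
      sweedler 2 l (fun l1 l2 l3 => sweedler 1 m (fun m1 m2 =>
        ω g1 l1 m1 * ω h1 (g2 ∙ l2) m2 * ω h2 g3 l3))));
  cq_omega1 : forall h g : H, ω h 1H g = ε h * ε g
}.

Record coquasi_antipode_axioms : Prop := {
  cq_anti_comul : forall h : H,
    Δ (S h) = sweedler 1 h (fun h1 h2 => S h2 ⊗ S h1);
  cq_anti_counit : forall h : H, ε (S h) = ε h;
  cq_anti_alpha : forall h : H,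
    sweedler 2 h (fun h1 h2 h3 => α h2 *: (S h1 ∙ h3)) = α h *: 1H;
  cq_anti_beta : forall h : H,
    sweedler 2 h (fun h1 h2 h3 => β h2 *: (h1 ∙ S h3)) = β h *: 1H;
  cq_anti_omega : forall h : H,
    sweedler 4 h (fun h1 h2 h3 h4 h5 =>
      ω h1 (S h3) h5 * β h2 * α h4) = ε h;
  cq_anti_omega_inv : forall h : H,
    sweedler 4 h (fun h1 h2 h3 h4 h5 =>
      ω' (S h1) h3 (S h5) * α h2 * β h4) = ε h;
  cq_alpha1 : α 1H = 1;
  cq_beta1 : β 1H = 1
}.
End CoquasiAxioms.

Record coquasi_Hopf (k : fieldType) := CoquasiHopf {
  cqH_data :> coquasi_data k;
  cqH_bialgebra : coquasi_bialgebra_axioms cqH_data;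
  cqH_antipode : coquasi_antipode_axioms cqH_data
}.

Record comodule_algebra_data (k : fieldType) (H : coquasi_Hopf k) :=
  ComoduleAlgebraData {
  ca_sort :> lmodType k;
  coact : {linear ca_sort -> (ca_sort ⊗ H)%type};
  ca_mul : {linear (ca_sort ⊗ ca_sort)%type -> ca_sort};
  ca_one : ca_sort
}.

Definition amul (k : fieldType) (H : coquasi_Hopf k)
  (A : comodule_algebra_data H) (a b : A) : A := ca_mul A (a ⊗ b).

Section ComoduleAlgebraAxioms.
Variables (k : fieldType) (H : coquasi_Hopf k) (A : comodule_algebra_data H).

Local Notation "h ∙ g" := (hmul h g) (at level 40, left associativity).
Local Notation "a ⋆ b" := (amul a b) (at level 40, left associativity).
Local Notation "'1H'" := (cq_one H).
Local Notation "'1A'" := (ca_one A).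
Local Notation ρ := (coact A).

Record comodule_algebra_axioms : Prop := {
  ca_coactA : forall a : A,
    tfold (fun a0 a1 => a0 ⊗ comul H a1) (ρ a) =
    tfold (fun a0 a1 => tfold (fun a00 a01 => a00 ⊗ (a01 ⊗ a1)) (ρ a0)) (ρ a);
  ca_coact_counit : forall a : A,
    tfold (fun a0 a1 => counit H a1 *: a0) (ρ a) = a;
  ca_mul_coact : forall a b : A,
    ρ (a ⋆ b) =
    tfold (fun a0 a1 => tfold (fun b0 b1 =>
      (a0 ⋆ b0) ⊗ (a1 ∙ b1)) (ρ b)) (ρ a);
  ca_one_coact : ρ 1A = 1A ⊗ 1H;
  ca_mul1l : forall a : A, 1A ⋆ a = a;
  ca_mul1r : forall a : A, a ⋆ 1A = a;
  ca_mulA : forall a b c : A,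
    (a ⋆ b) ⋆ c =
    tfold (fun a0 a1 => tfold (fun b0 b1 => tfold (fun c0 c1 =>
      omega a1 b1 c1 *: (a0 ⋆ (b0 ⋆ c0))) (ρ c)) (ρ b)) (ρ a)
}.
End ComoduleAlgebraAxioms.

Record comodule_algebra (k : fieldType) (H : coquasi_Hopf k) :=
  ComoduleAlgebra {
  ca_data :> comodule_algebra_data H;
  ca_axioms : comodule_algebra_axioms ca_data
}.

Local Open Scope classical_set_scope.

Definition coinvariants (k : fieldType) (H : coquasi_Hopf k)
  (A : comodule_algebra H) : set A :=
  [set a | coact A a = a ⊗ cq_one H].
Arguments coinvariants {k H} A a : rename.

(* The algebras and bimodules are subspaces (given as sets) of ambient vector
   spaces; their operations are only constrained on these subspaces. *)
Section Morita.
Variable k : fieldType.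

Definition subspace (E : lmodType k) (D : set E) : Prop :=
  D 0 /\ forall (a : k) x y, D x -> D y -> D (a *: x + y).

Definition bilinear_on (E1 E2 E3 : lmodType k)
    (D1 : set E1) (D2 : set E2) (D3 : set E3) (f : E1 -> E2 -> E3) : Prop :=
  [/\ forall x y, D1 x -> D2 y -> D3 (f x y),
      forall (a : k) x x' y, D1 x -> D1 x' -> D2 y ->
        f (a *: x + x') y = a *: f x y + f x' y
    & forall (a : k) x y y', D1 x -> D2 y -> D2 y' ->
        f x (a *: y + y') = a *: f x y + f x y'].

Record is_algebra (E : lmodType k) (D : set E)
    (mul : E -> E -> E) (one : E) : Prop := {
  alg_subspace : subspace D;
  alg_mul_bilinear : bilinear_on D D D mul;
  alg_one : D one;
  alg_mulA : forall x y z, D x -> D y -> D z ->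
    mul x (mul y z) = mul (mul x y) z;
  alg_mul1l : forall x, D x -> mul one x = x;
  alg_mul1r : forall x, D x -> mul x one = x
}.

Record is_bimodule (EL ER EM : lmodType k)
    (L : set EL) (mulL : EL -> EL -> EL) (oneL : EL)
    (R : set ER) (mulR : ER -> ER -> ER) (oneR : ER)
    (M : set EM) (lact : EL -> EM -> EM) (ract : EM -> ER -> EM) : Prop := {
  bim_subspace : subspace M;
  bim_lact_bilinear : bilinear_on L M M lact;
  bim_ract_bilinear : bilinear_on M R M ract;
  bim_lactA : forall x y m, L x -> L y -> M m ->
    lact x (lact y m) = lact (mulL x y) m;
  bim_lact1 : forall m, M m -> lact oneL m = m;
  bim_ractA : forall m x y, M m -> R x -> R y ->
    ract (ract m x) y = ract m (mulR x y);
  bim_ract1 : forall m, M m -> ract m oneR = m;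
  bim_lractA : forall x m y, L x -> M m -> R y ->
    ract (lact x m) y = lact x (ract m y)
}.

(* A morphism of (L1, L1)-bimodules from the tensor product M (x)_{L2} N to L1,
   presented as an L2-balanced k-bilinear map on M x N. *)
Record is_connecting (EL1 EL2 EM EN : lmodType k)
    (L1 : set EL1) (mul1 : EL1 -> EL1 -> EL1) (L2 : set EL2)
    (M : set EM) (lactM : EL1 -> EM -> EM) (ractM : EM -> EL2 -> EM)
    (N : set EN) (lactN : EL2 -> EN -> EN) (ractN : EN -> EL1 -> EN)
    (f : EM -> EN -> EL1) : Prop := {
  conn_bilinear : bilinear_on M N L1 f;
  conn_balanced : forall m x n, M m -> L2 x -> N n ->
    f (ractM m x) n = f m (lactN x n);
  conn_lact : forall x m n, L1 x -> M m -> N n ->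
    f (lactM x m) n = mul1 x (f m n);
  conn_ract : forall m n x, M m -> N n -> L1 x ->
    f m (ractN n x) = mul1 (f m n) x
}.

(* The Morita context (R, T, P, Q, pq, qp), with P a (T, R)-bimodule and Q an
   (R, T)-bimodule. *)
Record is_morita_context (ER ET EP EQ : lmodType k)
    (R : set ER) (mulR : ER -> ER -> ER) (oneR : ER)
    (T : set ET) (mulT : ET -> ET -> ET) (oneT : ET)
    (P : set EP) (lactP : ET -> EP -> EP) (ractP : EP -> ER -> EP)
    (Q : set EQ) (lactQ : ER -> EQ -> EQ) (ractQ : EQ -> ET -> EQ)
    (pq : EP -> EQ -> ET) (qp : EQ -> EP -> ER) : Prop := {
  mor_algR : is_algebra R mulR oneR;
  mor_algT : is_algebra T mulT oneT;
  mor_bimP : is_bimodule T mulT oneT R mulR oneR P lactP ractP;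
  mor_bimQ : is_bimodule R mulR oneR T mulT oneT Q lactQ ractQ;
  mor_pq : is_connecting T mulT R P lactP ractP Q lactQ ractQ pq;
  mor_qp : is_connecting R mulR T Q lactQ ractQ P lactP ractP qp;
  mor_assocP : forall p q p', P p -> Q q -> P p' ->
    lactP (pq p q) p' = ractP p (qp q p');
  mor_assocQ : forall q p q', Q q -> P p -> Q q' ->
    lactQ (qp q p) q' = ractQ q (pq p q')
}.
End Morita.

Section MA.
Variables (k : fieldType) (H : coquasi_Hopf k) (A : comodule_algebra H).

Local Notation "h ∙ g" := (hmul h g) (at level 40, left associativity).
Local Notation "a ⋆ b" := (amul a b) (at level 40, left associativity).
Local Notation "'1A'" := (ca_one A).
Local Notation ρ := (coact A).
Local Notation ω := (@omega k H).
Local Notation ω' := (@omega_inv k H).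
Local Notation S := (antipode H).
Local Notation β := (beta H).

Definition Hom_bar : set (H -> A) :=
  [set s | linear s /\ forall h,
     ρ (s h) = sweedler 2 h (fun h1 h2 h3 => s h2 ⊗ (S h1 ∙ h3))].

Definition bar_mul (s t : H -> A) : H -> A := fun h =>
  sweedler 9 h (fun h1 h2 h3 h4 h5 h6 h7 h8 h9 h10 =>
    (ω (S h2 ∙ h4) (S h8) h10 * β h6 * ω' (S h1) h5 (S h7)) *: (s h3 ⋆ t h9)).

Definition bar_one : H -> A := fun h => alpha H h *: 1A.

Definition Hom_coinv : set (H -> A) :=
  [set r | linear r /\ forall h, coinvariants A (r h)].

Definition conv_mul (r r' : H -> A) : H -> A := fun h =>
  sweedler 1 h (fun h1 h2 => r h1 ⋆ r' h2).

Definition conv_one : H -> A := fun h => counit H h *: 1A.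

Definition Hom_H : set (H -> A) :=
  [set p | linear p /\ forall h,
     ρ (p h) = sweedler 1 h (fun h1 h2 => p h1 ⊗ h2)].

Definition lact_H (r p : H -> A) : H -> A := fun h =>
  sweedler 1 h (fun h1 h2 => r h1 ⋆ p h2).

Definition ract_H (p s : H -> A) : H -> A := fun h =>
  sweedler 5 h (fun h1 h2 h3 h4 h5 h6 =>
    (β h3 * ω h2 (S h4) h6) *: (p h1 ⋆ s h5)).

Definition Hom_HS : set (H -> A) :=
  [set q | linear q /\ forall h,
     ρ (q h) = sweedler 1 h (fun h1 h2 => q h2 ⊗ S h1)].

Definition lact_HS (s q : H -> A) : H -> A := fun h =>
  sweedler 5 h (fun h1 h2 h3 h4 h5 h6 =>
    (β h4 * ω' (S h1) h3 (S h5)) *: (s h2 ⋆ q h6)).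

Definition ract_HS (q r : H -> A) : H -> A := fun h =>
  sweedler 1 h (fun h1 h2 => q h1 ⋆ r h2).

Definition pairing_pq (p q : H -> A) : H -> A := fun h =>
  sweedler 2 h (fun h1 h2 h3 => β h2 *: (p h1 ⋆ q h3)).

Definition pairing_qp (q p : H -> A) : H -> A := fun h =>
  sweedler 1 h (fun h1 h2 => q h1 ⋆ p h2).
End MA.

Arguments Hom_bar {k H} A s : rename.
Arguments Hom_coinv {k H} A r : rename.
Arguments Hom_H {k H} A p : rename.
Arguments Hom_HS {k H} A q : rename.
Arguments bar_mul {k H} A s t h.
Arguments bar_one {k H} A h.
Arguments conv_mul {k H} A r r' h.
Arguments conv_one {k H} A h.
Arguments lact_H {k H} A r p h.
Arguments ract_H {k H} A p s h.
Arguments lact_HS {k H} A s q h.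
Arguments ract_HS {k H} A q r h.
Arguments pairing_pq {k H} A p q h.
Arguments pairing_qp {k H} A q p h.

(* Main.v *)
Require Import Defs.
From mathcomp Require Import all_boot all_algebra.
From mathcomp Require Import boolp classical_sets functions.
From mathcomp Require Import ring.

(** Apart from linearity, the axioms of a Morita context are the associativity
    and unit laws of a category with two objects; the proof builds this
    category and recognises the operations in it.

    For a coalgebra map σ : H -> H let H_σ be the space H with the right
    coaction h |-> h1 ⊗ σ(h2).  The cases of interest are σ = id, which gives
    the regular comodule, and σ = ε(-)1, which gives a trivial one.  Since A is
    an algebra in the monoidal category of right comodules, the colinear maps
    H_σ -> H_τ ⊗ A compose as in the Kleisli category of - ⊗ A, with ω as the
    associativity constraint.  Those that respect the left coaction Δ are
    h |-> h1 ⊗ f(h2) for a unique linear f : H -> A; colinearity of the map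
    becomes the condition [is_kernel] on f, composition becomes [kleisli], and
    [kleisli_assoc] is where the 3-cocycle identity is spent.

    With the two objects ε(-)1 and id, the endomorphisms of ε(-)1 are Hom(H,B)
    and the maps id -> ε(-)1 are Hom^H(H,A).  The two other spaces are made of
    maps q whose coaction is twisted as S(h1) ⊗ q(h2) ⊗ σ(h3)
    ([is_twisted]): these are kernels of maps into the regular comodule, moved
    to the other side along the duality that S, α and β provide.  The passages
    [transpose] and [untranspose] are mutually inverse because of the zigzag
    identities ([transposeK], [untransposeK]).  Transporting composition along
    them yields exactly the products and actions with their factors ω, β and
    ω^-1; this is the content of [untranspose_kleisli] and of its
    specialisations [untranspose_kleisli_unit_map] and
    [untranspose_kleisli_transpose].  Each operation of the context is then
    composition [hom_comp] between two of the objects (lemmas [_presents]), and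
    the theorem follows from [presents_assoc], [presents_1l] and [presents_1r].

    The calculations are in Sweedler notation.  Their bookkeeping is done once
    and for all by [regroup_legs]: a nested sum of coproducts applied to a
    multilinear expression depends only on the number of legs into which each
    initial element is split, legs absorbed by the counit being discounted.
    The tactic [regroup] reads off the data of this lemma from the goal, so
    that a proof is a list of Sweedler expressions in which the legs alternate
    between the grouping wanted by the next identity and the flat one. *)

Set Implicit Arguments.
Unset Strict Implicit.
Unset Printing Implicit Defensive.
Import GRing.Theory.
Local Open Scope ring_scope.

Local Notation "'Δ[' x , y <- h ] E" := (tfold (fun x y => E) (comul _ h))
  (at level 40, x name, y name, h at level 200, E at level 40).

(** * Sums over the legs of a tensor, and coassociativity *)

Section FormalSums.
Variable k : fieldType.
Implicit Types V W U X Y : lmodType k.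

Lemma linear_val0 V W (f : V -> W) : linear f -> f 0 = 0.
Proof. by move=> fl; have := fl (-1) 0 0; rewrite scaler0 addr0 scaleN1r addNr. Qed.

Lemma linear_valD V W (f : V -> W) x y : linear f -> f (x + y) = f x + f y.
Proof. by move=> fl; have := fl 1 x y; rewrite !scale1r. Qed.

Lemma linear_valZ V W (f : V -> W) a x : linear f -> f (a *: x) = a *: f x.
Proof. by move=> fl; have := fl a x 0; rewrite (linear_val0 fl) !addr0. Qed.

Lemma eq_tfold V W (U : nmodType) (f g : V -> W -> U) t :
  (forall v w, f v w = g v w) -> tfold f t = tfold g t.
Proof. by move=> fg; apply: eq_bigr => p _; apply: fg. Qed.

Lemma tfold_exchange V W X Y (U : nmodType) (f : V -> W -> X -> Y -> U) t s :
  tfold (fun v w => tfold (f v w) s) t =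
  tfold (fun x y => tfold (fun v w => f v w x y) t) s.
Proof. exact: exchange_big. Qed.

(** [tfold] is a sum over a fixed list of representatives, so that L passes
    through it even when f is not bilinear. *)
Lemma tfold_map V W X Y (L : X -> Y) (f : V -> W -> X) t :
  linear L -> L (tfold f t) = tfold (fun v w => L (f v w)) t.
Proof.
move=> Ll; rewrite /tfold.
by apply: (big_morph L) => [x y|]; [exact: linear_valD | exact: linear_val0].
Qed.

Lemma scaler_tfold V W X (a : k) (f : V -> W -> X) t :
  a *: tfold f t = tfold (fun v w => a *: f v w) t.
Proof. exact: scaler_sumr. Qed.

Lemma tfold_scaler V W X (f : V -> W -> k) (u : X) t :
  tfold f t *: u = tfold (fun v w => f v w *: u) t.
Proof. exact: scaler_suml. Qed.

Lemma tfold_tfold V W X Y U (f : V -> W -> U) (G : X -> Y -> (V ⊗ W)%type) t :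
  (forall w, linear (f^~ w)) -> (forall v, linear (f v)) ->
  tfold f (tfold G t) = tfold (fun x y => tfold f (G x y)) t.
Proof. by move=> fl fr; apply: tfold_map; apply: tfold_linear. Qed.

Lemma linear_id V : linear (fun x : V => x).
Proof. by []. Qed.

Lemma linear_eval (T : Type) V (t : T) : linear (fun f : T -> V => f t).
Proof. by []. Qed.

Lemma linear_fun (T : Type) V W (F : V -> T -> W) :
  (forall t, linear (fun x => F x t)) -> linear F.
Proof. by move=> Fl a x y; apply: funext => t; rewrite Fl. Qed.

Lemma linear_comp V W U (f : W -> U) (g : V -> W) :
  linear f -> linear g -> linear (fun x => f (g x)).
Proof. by move=> fl gl a x y; rewrite gl fl. Qed.

Lemma linear_scale V W (c : k) (g : V -> W) :
  linear g -> linear (fun x => c *: g x).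
Proof. by move=> gl a x y; rewrite gl scalerDr !scalerA mulrC. Qed.

Lemma scalar_scale V W (c : V -> k) (u : W) :
  scalar c -> linear (fun x => c x *: u).
Proof. by move=> cl a x y; rewrite cl scalerDl scalerA. Qed.

Lemma scalar_comp V W (f : W -> k) (g : V -> W) :
  scalar f -> linear g -> scalar (fun x => f (g x)).
Proof. by move=> fl gl a x y; rewrite gl fl. Qed.

Lemma scalar_mull V (c : k) (g : V -> k) : scalar g -> scalar (fun x => c * g x).
Proof. by move=> gl a x y; rewrite gl mulrDr mulrCA. Qed.

Lemma scalar_mulr V (c : k) (g : V -> k) : scalar g -> scalar (fun x => g x * c).
Proof. by move=> gl a x y; rewrite gl mulrDl mulrA. Qed.

Lemma linear_purel V W X (f : X -> V) (w : W) : linear f -> linear (fun x => f x ⊗ w).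
Proof. by move=> fl a x y; rewrite fl pureDl pureZl. Qed.

Lemma linear_purer V W X (f : X -> W) (v : V) : linear f -> linear (fun x => v ⊗ f x).
Proof. by move=> fl a x y; rewrite fl pureDr pureZr. Qed.

Lemma linear_tfold_body X V W U (f : X -> V -> W -> U) t :
  (forall v w, linear (fun x => f x v w)) -> linear (fun x => tfold (f x) t).
Proof.
move=> fl a x y; rewrite /tfold scaler_sumr -big_split /=.
by apply: eq_bigr => p _; apply: fl.
Qed.

Lemma linear_tfold_arg X V W U (f : V -> W -> U) (g : X -> (V ⊗ W)%type) :
  (forall w, linear (fun v => f v w)) -> (forall v, linear (fun w => f v w)) -> linear g ->
  linear (fun x => tfold f (g x)).
Proof. by move=> fl fr gl; apply: linear_comp gl; apply: tfold_linear. Qed.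

Lemma tfold_id V W (t : (V ⊗ W)%type) : tfold (fun v w => v ⊗ w) t = t.
Proof. by rewrite [RHS]tensor_reprE. Qed.

End FormalSums.

Section Regroup.
Variables (k : fieldType) (H : coalgebra k) (U : lmodType k).
Implicit Types (F G : seq H -> U) (L : seq H) (h : H).

Lemma coassoc (F : H -> H -> H -> U) h :
  (forall y z, linear (fun x => F x y z)) ->
  (forall x z, linear (fun y => F x y z)) ->
  (forall x y, linear (fun z => F x y z)) ->
  Δ[x, h3 <- h] Δ[h1, h2 <- x] F h1 h2 h3 = Δ[h1, y <- h] Δ[h2, h3 <- y] F h1 h2 h3.
Proof.
move=> F1 F2 F3.
pose T := fun x (t : (H ⊗ H)%type) => tfold (F x) t.
have Tl x : linear (T x) by apply: tfold_linear.
have Tr t : linear (fun x => T x t) by apply: linear_tfold_body => v w; apply: F1.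
have T2 : linear (tfold T) by apply: tfold_linear.
have /(congr1 (tfold T)) := comulA h; rewrite !tfold_tfold //.
have -> : Δ[h1, y <- h] Δ[h2, h3 <- y] F h1 h2 h3 =
  tfold (fun x y => tfold T (x ⊗ comul H y)) (comul H h).
  by apply: eq_tfold => x y; rewrite tfold_pure.
move=> ->; apply: eq_tfold => x y; rewrite tfold_tfold //.
by apply: eq_tfold => x1 x2; rewrite tfold_pure // /T tfold_pure.
Qed.

Lemma tfold_counitl (F : H -> U) h : linear F -> Δ[x, y <- h] (counit H x *: F y) = F h.
Proof.
move=> Fl; rewrite -[in RHS](counitl h) (tfold_map _ _ Fl).
by apply: eq_tfold => x y; rewrite linear_valZ.
Qed.

Lemma tfold_counitr (F : H -> U) h : linear F -> Δ[x, y <- h] (counit H y *: F x) = F h.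
Proof.
move=> Fl; rewrite -[in RHS](counitr h) (tfold_map _ _ Fl).
by apply: eq_tfold => x y; rewrite linear_valZ.
Qed.

(** Expressions in Sweedler notation are encoded as functions F of the list of
    their legs, so that a leg is a position; only lists of length n matter. *)
Definition multilinear n F : Prop := forall L1 L2,
  (size L1 + size L2).+1 = n -> linear (fun x => F (L1 ++ x :: L2)).

(** Splits the i-th leg in place; the two halves take positions i and i+1, so
    that lists of legs stay in the order of the iterated coproduct. *)
Fixpoint cop_at i L F : U := if L is x :: L' then
    if i is i'.+1 then cop_at i' L' (fun M => F (x :: M))
    else Δ[x1, x2 <- x] F (x1 :: x2 :: L')
  else 0.

Fixpoint counit_at i F L : U := if L is x :: L' then
    if i is i'.+1 then counit_at i' (fun M => F (x :: M)) L'
    else counit H x *: F L'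
  else 0.

Fixpoint cops n h F : U :=
  if n is n'.+1 then Δ[x, y <- h] cops n' y (fun L => F (x :: L)) else F [:: h].

(** The normal form: the j-th element of env is split into as many legs as
    [cops] makes of it (n cuts give n+1 legs), the legs of different elements
    being listed one block after the other. *)
Fixpoint canon (s : seq nat) (env : seq H) F : U :=
  match s, env with
  | n :: s', h :: env' => cops n h (fun L => canon s' env' (fun M => F (L ++ M)))
  | _, _ => F [::]
  end.

(** A nested sum of coproducts is a list of positions: the legs to be split,
    each position referring to the list of legs obtained so far. *)
Fixpoint run (p : seq nat) env F : U :=
  if p is i :: p' then cop_at i env (fun L => run p' L F) else F env.

(** The effect of [cop_at i] on the numbers of cuts of the blocks. *)
Fixpoint incr_block i (s : seq nat) : seq nat := match s with
  | n :: s' => if (i <= n)%N then n.+1 :: s' else n :: incr_block (i - n.+1)%N s'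
  | [::] => [::]
  end.

Lemma eq_cops n h F G : (forall L, size L = n.+1 -> F L = G L) -> cops n h F = cops n h G.
Proof.
elim: n h F G => [|n IH] h F G FG /=; first exact: FG.
by apply: eq_tfold => x y; apply: IH => L sL; apply: FG; rewrite /= sL.
Qed.

Lemma eq_canon s env F G : size s = size env ->
  (forall L, size L = sumn (map S s) -> F L = G L) -> canon s env F = canon s env G.
Proof.
elim: s env F G => [|n s IH] [|h env] F G //= => [_|[sz]] FG; first exact: FG.
apply: eq_cops => L sL; apply: IH => // M sM; apply: FG.
by rewrite size_cat sL sM.
Qed.

Lemma linear_cop_at X i L (F : X -> seq H -> U) (a : k) (x y z : X) :
  (forall M, size M = (size L).+1 -> F z M = a *: F x M + F y M) ->
  cop_at i L (F z) = a *: cop_at i L (F x) + cop_at i L (F y).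
Proof.
elim: L i F => [|h L IH] [|i] F Fl /=; rewrite ?scaler0 ?addr0 //.
  rewrite scaler_sumr -big_split; apply: eq_bigr => p _ /=.
  by rewrite Fl.
by apply: (IH i (fun x M => F x (h :: M))) => M sM; apply: Fl; rewrite /= sM.
Qed.

Lemma linear_counit_at X i L (F : X -> seq H -> U) (a : k) (x y z : X) :
  (forall M, (size M).+1 = (size L) -> F z M = a *: F x M + F y M) ->
  counit_at i (F z) L = a *: counit_at i (F x) L + counit_at i (F y) L.
Proof.
elim: L i F => [|h L IH] [|i] F Fl /=; rewrite ?scaler0 ?addr0 //.
  by rewrite Fl // scalerDr !scalerA mulrC.
by apply: (IH i (fun x M => F x (h :: M))) => M sM; apply: Fl; rewrite /= sM.
Qed.

Lemma multilinear_cons n x F :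
  multilinear n.+1 F -> multilinear n (fun L => F (x :: L)).
Proof. by move=> Fl L1 L2 sL; apply: (Fl (x :: L1) L2); rewrite -sL. Qed.

Lemma multilinear_cop_at n i F : (i < n)%N ->
  multilinear n.+1 F -> multilinear n (fun L => cop_at i L F).
Proof.
elim: i n F => [|i IH] [//|n] F lt_in Fl [|y L1] L2 /= [sL].
- apply: linear_tfold_arg => [w|v|].
  + by apply: (Fl [::] (w :: L2)); rewrite /= -sL.
  + by apply: (Fl [:: v] L2); rewrite /= -sL.
  + by move=> a x y; rewrite linearP.
- apply: linear_tfold_body => v w.
  by apply: (Fl [:: v, w & L1] L2); rewrite /= -sL.
- move=> a x y; apply: (@linear_cop_at _ _ _ (fun x M => F (x :: M))) => M sM.
  by apply: (Fl [::] M); rewrite /= -sL -sM.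
- by apply: (IH n (fun L => F (y :: L))) => //; exact: multilinear_cons.
Qed.

Lemma multilinear_counit_at n i F : (i <= n)%N ->
  multilinear n F -> multilinear n.+1 (counit_at i F).
Proof.
elim: i n F => [|i IH] n F le_in Fl [|y L1] L2 /= [sL].
- by apply: scalar_scale => a x y; rewrite linearP.
- by apply: linear_scale; apply: Fl; rewrite -sL.
- move=> a x y; apply: (@linear_counit_at _ _ _ (fun x M => F (x :: M))) => M sM.
  by apply: (Fl [::] M); rewrite /= sM -sL.
- case: n le_in Fl sL => // n le_in Fl sL.
  by apply: (IH n (fun L => F (y :: L))) => //; exact: multilinear_cons.
Qed.

Lemma cops_comb n h (a : k) F1 F2 F3 :
  (forall L, size L = n.+1 -> F1 L = a *: F2 L + F3 L) ->
  cops n h F1 = a *: cops n h F2 + cops n h F3.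
Proof.
elim: n h F1 F2 F3 => [|n IH] h F1 F2 F3 E /=; first exact: E.
rewrite scaler_sumr -big_split; apply: eq_bigr => p _ /=.
by apply: IH => L sL; apply: E; rewrite /= sL.
Qed.

Lemma linear_cops n F : multilinear n.+1 F -> linear (fun h => cops n h F).
Proof.
elim: n F => [|n IH] F Fl /=; first exact: (Fl [::] [::]).
apply: linear_tfold_arg => [w|v|].
- by move=> a x y; apply: cops_comb => L sL; apply: (Fl [::] L); rewrite /= sL.
- by apply: IH; exact: multilinear_cons.
- by move=> a x y; rewrite linearP.
Qed.

Lemma cops_exchange n h (V W : lmodType k) (F : V -> W -> seq H -> U) t :
  cops n h (fun L => tfold (fun v w => F v w L) t) =
  tfold (fun v w => cops n h (F v w)) t.
Proof.
elim: n h F => [//|n IH] h F /=.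
rewrite [RHS]tfold_exchange; apply: eq_tfold => x y.
by rewrite (IH y (fun v w L => F v w (x :: L))).
Qed.

(** Splitting the first leg is moved inward by coassociativity, and the others
    are handled by induction, as [cops] always splits the last leg. *)
Lemma cops_cop_at n h i F : (i <= n)%N -> multilinear n.+2 F ->
  cops n h (fun L => cop_at i L F) = cops n.+1 h F.
Proof.
elim: n i h F => [|n IH] [|i] h F //= le_in Fl; last first.
  apply: eq_tfold => x y.
  by apply: (IH i y (fun L => F (x :: L))) => //; apply: multilinear_cons.
rewrite -(coassoc (F := fun x y z => cops n z (fun L => F [:: x, y & L]))) /=.
- by apply: eq_tfold => x y; rewrite cops_exchange.
- by move=> y z a x x'; apply: cops_comb => L sL; apply: (Fl [::] (y :: L)); rewrite /= sL.
- by move=> x z a y y'; apply: cops_comb => L sL; apply: (Fl [:: x] L); rewrite /= sL.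
- move=> x y; apply: linear_cops.
  by apply: (@multilinear_cons _ y (fun L => F (x :: L))); exact: multilinear_cons.
Qed.

Lemma canon_exchange s env (V W : lmodType k) (F : V -> W -> seq H -> U) t :
  size s = size env ->
  canon s env (fun L => tfold (fun v w => F v w L) t) =
  tfold (fun v w => canon s env (F v w)) t.
Proof.
elim: s env F => [|n s IH] [|h env] F //= [sz].
rewrite -cops_exchange; apply: eq_cops => L sL.
by rewrite (IH env (fun v w M => F v w (L ++ M))).
Qed.

Lemma cop_at_canon s env i L (F : seq H -> seq H -> U) :
  size s = size env -> (i < size L)%N ->
  canon s env (fun M => cop_at i L (fun L' => F L' M)) =
  cop_at i L (fun L' => canon s env (F L')).
Proof.
move=> sz; elim: L i F => [|x L IH] [|i] F //= lt_i; first by rewrite canon_exchange.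
exact: (IH i (fun L' M => F (x :: L') M)).
Qed.

Lemma canon_comb s env (a : k) F1 F2 F3 : size s = size env ->
  (forall L, size L = sumn (map S s) -> F1 L = a *: F2 L + F3 L) ->
  canon s env F1 = a *: canon s env F2 + canon s env F3.
Proof.
elim: s env F1 F2 F3 => [|n s IH] [|h env] F1 F2 F3 //= => [_|[sz]] E; first exact: E.
apply: cops_comb => L sL; apply: IH => // M sM; apply: E.
by rewrite size_cat sL sM.
Qed.

Lemma cop_at_cat i L M F : (i < size L)%N ->
  cop_at i (L ++ M) F = cop_at i L (fun L' => F (L' ++ M)).
Proof. by elim: L i F => [|x L IH] [|i] F //= lt_i; rewrite IH. Qed.

Lemma cop_at_catr i L M F : (size L <= i)%N ->
  cop_at i (L ++ M) F = cop_at (i - size L) M (fun M' => F (L ++ M')).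
Proof. by elim: L i F => [|x L IH] [|i] F //= lt_i; rewrite IH. Qed.

Lemma multilinear_catl m n L F : size L = m ->
  multilinear (m + n) F -> multilinear n (fun M => F (L ++ M)).
Proof.
move=> sL Fl L1 L2 s12 a x y; rewrite !catA; apply: Fl.
by rewrite size_cat sL -addnA -addnS s12.
Qed.

Lemma canon_cop_at s env i F : size s = size env -> (i < sumn (map S s))%N ->
  multilinear (sumn (map S s)).+1 F ->
  canon s env (fun L => cop_at i L F) = canon (incr_block i s) env F.
Proof.
elim: s env i F => [|n s IH] [|h env] i F //= [sz] lt_i Fl.
case: leqP => [le_in|lt_ni] /=.
  pose G L := canon s env (fun M => F (L ++ M)).
  apply: etrans (@cops_cop_at n h i G le_in _); last first.
    move=> L1 L2 s12 a x y; apply: canon_comb => // M sM.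
    by rewrite -!catA /=; apply: Fl; rewrite size_cat sM addnA -addSn s12.
  apply: eq_cops => L sL.
  rewrite -cop_at_canon ?sL //; apply: eq_canon => // M sM.
  by rewrite cop_at_cat // sL.
apply: eq_cops => L sL.
rewrite -IH //.
- by apply: eq_canon => // M sM; rewrite cop_at_catr sL.
- by rewrite ltn_subLR.
- by apply: (multilinear_catl sL); rewrite addnS.
Qed.

Fixpoint valid (p : seq nat) m : bool :=
  if p is i :: p' then (i < m)%N && valid p' m.+1 else true.

Lemma multilinear_run p m F : valid p m ->
  multilinear (size p + m) F -> multilinear m (fun L => run p L F).
Proof.
elim: p m => //= i p IH m /andP[im vp] Fl.
by apply: multilinear_cop_at => //; apply: IH => //; rewrite addnS.
Qed.

Lemma size_incr_block i s : (i < sumn (map S s))%N ->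
  size (incr_block i s) = size s /\ sumn (map S (incr_block i s)) = (sumn (map S s)).+1.
Proof.
elim: s i => //= n s IH i lt_i; case: leqP => [//|lt_n] /=.
have [|-> ->] := IH (i - n.+1)%N.
  by rewrite ltn_subLR.
by rewrite addnS.
Qed.

Lemma canon_run s env p F : size s = size env -> valid p (sumn (map S s)) ->
  multilinear (size p + sumn (map S s)) F ->
  canon s env (fun L => run p L F) = canon (foldl (fun s i => incr_block i s) s p) env F.
Proof.
elim: p s => //= i p IH s sz /andP[lt_i vp] Fl.
have [ss sm] := size_incr_block lt_i.
rewrite canon_cop_at //; last by apply: multilinear_run => //; rewrite addnS.
by apply: IH; rewrite ?ss ?sm // addnS.
Qed.

Definition shape p m := foldl (fun s i => incr_block i s) (nseq m 0%N) p.

Lemma canon0 env F : canon (nseq (size env) 0%N) env F = F env.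
Proof. by elim: env F => //= h env IH F; rewrite IH. Qed.

Lemma sumn_nseq0 m : sumn (map S (nseq m 0%N)) = m.
Proof. by elim: m => //= m ->. Qed.

Lemma run_shape p env F : valid p (size env) -> multilinear (size p + size env) F ->
  run p env F = canon (shape p (size env)) env F.
Proof.
move=> vp Fl; rewrite -canon_run ?size_nseq ?sumn_nseq0 //.
by rewrite canon0.
Qed.

(** The counit axioms: the split leg may lose either of its halves. *)
Lemma cop_at_counit_at i j n L F : (i <= j <= i.+1)%N -> (i < n)%N -> (size L = n)%N ->
  multilinear n F -> cop_at i L (counit_at j F) = F L.
Proof.
elim: i j n L F => [|i IH] [|j] [|n] [|x L] F //= ij lt_i [sL] Fl.
- by rewrite -[RHS](tfold_counitl (F := fun y => F (y :: L))) //; apply: (Fl [::] L); rewrite /= sL.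
- case: j ij => // _.
  by rewrite -[RHS](tfold_counitr (F := fun y => F (y :: L))) //; apply: (Fl [::] L); rewrite /= sL.
- by apply: (IH j n L (fun L => F (x :: L))) => //; exact: multilinear_cons.
Qed.

Fixpoint decr_block j (s : seq nat) : seq nat := match s with
  | n :: s' => if (j <= n)%N then n.-1 :: s' else n :: decr_block (j - n.+1)%N s'
  | [::] => [::]
  end.

(** The position that [cop_at] must split for the j-th leg to be one of the two
    halves.  It is j, except when the j-th leg is the last of its block. *)
Definition twin j s := if incr_block j (decr_block j s) == s then j else j.-1.

(** The j-th leg can be dropped when its block has another leg. *)
Definition droppable j s :=
  let s' := decr_block j s in let i := twin j s in
  [&& size s' == size s, incr_block i s' == s, (i <= j <= i.+1)%N & (i < sumn (map S s'))%N].

Lemma canon_counit_at j s env F : size s = size env -> droppable j s ->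
  multilinear (sumn (map S s)).-1 F ->
  canon s env (counit_at j F) = canon (decr_block j s) env F.
Proof.
move=> sz /and4P[/eqP ss /eqP es ij lt_i].
have [_] := size_incr_block lt_i; rewrite es => -> /= Fl.
rewrite -[in LHS]es -canon_cop_at ?ss //.
  by apply: eq_canon; rewrite ?ss // => L sL; apply: cop_at_counit_at ij lt_i sL Fl.
by apply: multilinear_counit_at => //; case/andP: ij => _ /leq_trans; apply.
Qed.

(** The positions in js are read one after the other, each in the list from
    which the previous ones have been deleted. *)
Fixpoint drops js s : option (seq nat) :=
  if js is j :: js' then if droppable j s then drops js' (decr_block j s) else None
  else Some s.

Definition counits js F := foldr counit_at F js.

Lemma canon_counits js s s' env F : size s = size env -> drops js s = Some s' ->
  multilinear (sumn (map S s')) F ->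
  multilinear (sumn (map S s)) (counits js F) /\
  canon s env (counits js F) = canon s' env F.
Proof.
elim: js s => [|j js IH] s sz /=; first by move=> [->].
case: ifP => // dj dr Fl.
have /and4P[/eqP ss /eqP es ij lt_i] := dj.
have [_] := size_incr_block lt_i; rewrite es => sm.
have [|Gl Ge] := IH (decr_block j s) _ dr Fl; first by rewrite ss.
have Gl' : multilinear (sumn (map S s)).-1 (counits js F) by rewrite sm.
split; last by rewrite canon_counit_at.
rewrite sm; apply: multilinear_counit_at => //.
by case/andP: ij => _ /leq_trans; apply.
Qed.

Fixpoint uncurry n : legs H U n -> seq H -> U :=
  match n return legs H U n -> seq H -> U with
  | 0%N => fun u L => u
  | n'.+1 => fun f L => if L is x :: L' then uncurry (f x) L' else 0
  end.

(** Multilinearity is restated for curried expressions, since those are what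
    a goal displays. *)
Fixpoint linear_legs n : (H -> legs H U n) -> Prop :=
  match n return (H -> legs H U n) -> Prop with
  | 0%N => fun f => linear (fun x => f x : U)
  | n'.+1 => fun f => forall y, linear_legs (fun x => f x y)
  end.

Fixpoint multilinear_legs n : legs H U n -> Prop :=
  match n return legs H U n -> Prop with
  | 0%N => fun _ => True
  | n'.+1 => fun f => linear_legs f /\ forall x, multilinear_legs (f x)
  end.

Lemma linear_uncurry n (f : H -> legs H U n) L : size L = n ->
  linear_legs f -> linear (fun x => uncurry (f x) L).
Proof. by elim: n f L => [|n IH] f [|y L] //= [sL] fl; apply: IH. Qed.

Lemma multilinear_uncurry n (f : legs H U n) :
  multilinear_legs f -> multilinear n (uncurry f).
Proof.
elim: n f => [|n IH] f //= [f1 f2] [|y L1] L2 /= [sL]; last exact: IH.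
exact: linear_uncurry.
Qed.

Definition same_shape n p1 js p2 m :=
  [&& valid p1 m, valid p2 m, (size p2 + m == n)%N & drops js (shape p1 m) == Some (shape p2 m)].

Lemma foldl_incr_block p s : valid p (sumn (map S s)) ->
  let s' := foldl (fun s i => incr_block i s) s p in
  size s' = size s /\ sumn (map S s') = (size p + sumn (map S s))%N.
Proof.
elim: p s => //= i p IH s /andP[lt_i vp].
have [<- sm] := size_incr_block lt_i.
have [|-> ->] := IH (incr_block i s); first by rewrite sm.
by rewrite sm addnS.
Qed.

Lemma shape_sumn p m : valid p m ->
  size (shape p m) = m /\ sumn (map S (shape p m)) = (size p + m)%N.
Proof.
move=> vp; have [] := @foldl_incr_block p (nseq m 0%N); rewrite ?sumn_nseq0 //.
by rewrite size_nseq.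
Qed.

(** Both sides have the same normal form [canon], because their programs cut
    every initial element into the same number of legs once the legs in js are
    deleted.  The condition [same_shape] is decided by evaluation. *)
Lemma regroup_legs n (env : seq H) p1 js p2 (f : legs H U n) :
  same_shape n p1 js p2 (size env) -> multilinear_legs f ->
  run p1 env (counits js (uncurry f)) = run p2 env (uncurry f).
Proof.
move=> /and4P[v1 v2 /eqP s2 /eqP dr] /multilinear_uncurry fl.
have [ss1 sm1] := shape_sumn v1; have [ss2 sm2] := shape_sumn v2.
have fl2 : multilinear (size p2 + size env) (uncurry f).
  by move=> L1 L2 s12; apply: fl; rewrite s12.
have [|Gl Ge] := @canon_counits js _ _ env (uncurry f) ss1 dr.
  by rewrite sm2.
by rewrite !run_shape // -sm1.
Qed.

End Regroup.

(** * Tactics for Sweedler notation *)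

Section StructureMaps.
Variables (k : fieldType).

Lemma linear_hmull (H : coquasi_data k) (V : lmodType k) (f : V -> H) (g : H) :
  linear f -> linear (fun x => hmul (f x) g).
Proof. by move=> fl a x y; rewrite /hmul fl pureDl pureZl linearP. Qed.

Lemma linear_hmulr (H : coquasi_data k) (V : lmodType k) (f : V -> H) (g : H) :
  linear f -> linear (fun x => hmul g (f x)).
Proof. by move=> fl a x y; rewrite /hmul fl pureDr pureZr linearP. Qed.

Lemma linear_amull (H : coquasi_Hopf k) (A : comodule_algebra_data H)
    (V : lmodType k) (f : V -> A) (g : A) :
  linear f -> linear (fun x => amul (f x) g).
Proof. by move=> fl a x y; rewrite /amul fl pureDl pureZl linearP. Qed.

Lemma linear_amulr (H : coquasi_Hopf k) (A : comodule_algebra_data H)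
    (V : lmodType k) (f : V -> A) (g : A) :
  linear f -> linear (fun x => amul g (f x)).
Proof. by move=> fl a x y; rewrite /amul fl pureDr pureZr linearP. Qed.

Section Scalars.
Variables (H : coquasi_data k) (V : lmodType k) (f : V -> H) (g l : H) (fl : linear f).

Lemma scalar_omega1 : scalar (fun x => omega (f x) g l).
Proof. by move=> a x y; rewrite /omega fl !(pureDl, pureZl) linearP. Qed.

Lemma scalar_omega2 : scalar (fun x => omega g (f x) l).
Proof. by move=> a x y; rewrite /omega fl !(pureDl, pureZl, pureDr, pureZr) linearP. Qed.

Lemma scalar_omega3 : scalar (fun x => omega g l (f x)).
Proof. by move=> a x y; rewrite /omega fl !(pureDr, pureZr) linearP. Qed.

Lemma scalar_omega_inv1 : scalar (fun x => omega_inv (f x) g l).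
Proof. by move=> a x y; rewrite /omega_inv fl !(pureDl, pureZl) linearP. Qed.

Lemma scalar_omega_inv2 : scalar (fun x => omega_inv g (f x) l).
Proof. by move=> a x y; rewrite /omega_inv fl !(pureDl, pureZl, pureDr, pureZr) linearP. Qed.

Lemma scalar_omega_inv3 : scalar (fun x => omega_inv g l (f x)).
Proof. by move=> a x y; rewrite /omega_inv fl !(pureDr, pureZr) linearP. Qed.

End Scalars.
End StructureMaps.

(** Linearity is syntax-directed: the head symbol of the expression, and the
    argument in which the variable occurs, determine the closure lemma.  The
    patterns fun _ => ?d recognise the constant arguments. *)
Ltac lin_hyp f g :=
  first [apply: (@linear_comp _ _ _ _ f g); [solve [auto]|lin]
        |apply: (@scalar_comp _ _ _ f g); [solve [auto]|lin]]
with lin :=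
  intros; cbv beta;
  lazymatch goal with
  | |- GRing.linear_for ?s ?f => lazymatch f with
    | (fun x => _) => idtac
    | _ => change (GRing.linear_for s (fun x => f x))
    end
  end;
  lazymatch goal with
  | |- GRing.linear_for _ (fun x => x) => exact: linear_id
  | |- GRing.linear_for _ (fun x => x ?c) => exact: linear_eval
  | |- GRing.linear_for _ (fun x => tfold (@?g x) (@?t x)) =>
      lazymatch t with
      | fun _ => ?d => apply: linear_tfold_body; lin
      | _ => apply: linear_tfold_arg; lin
      end
  | |- GRing.linear_for _ (fun x => @GRing.scale _ _ (@?f x) (@?g x)) =>
      lazymatch f with
      | fun _ => ?d => apply: linear_scale; lin
      | _ => apply: scalar_scale; lin
      end
  | |- GRing.linear_for _ (fun x => hmul (@?f x) (@?g x)) =>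
      lazymatch f with
      | fun _ => ?d => apply: linear_hmulr; lin
      | _ => apply: linear_hmull; lin
      end
  | |- GRing.linear_for _ (fun x => amul (@?f x) (@?g x)) =>
      lazymatch f with
      | fun _ => ?d => apply: linear_amulr; lin
      | _ => apply: linear_amull; lin
      end
  | |- GRing.linear_for _ (fun x => pure (@?f x) (@?g x)) =>
      lazymatch f with
      | fun _ => ?d => apply: linear_purer; lin
      | _ => apply: linear_purel; lin
      end
  | |- GRing.linear_for _ (fun x => @GRing.mul _ (@?f x) (@?g x)) =>
      lazymatch f with
      | fun _ => ?d => apply: scalar_mull; lin
      | _ => apply: scalar_mulr; lin
      end
  | |- GRing.linear_for _ (fun x => omega (@?f x) (@?g x) (@?h x)) =>
      lazymatch constr:((f, g)) with
      | (fun _ => ?d, fun _ => ?e) => apply: scalar_omega3; lin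
      | (fun _ => ?d, _) => apply: scalar_omega2; lin
      | _ => apply: scalar_omega1; lin
      end
  | |- GRing.linear_for _ (fun x => omega_inv (@?f x) (@?g x) (@?h x)) =>
      lazymatch constr:((f, g)) with
      | (fun _ => ?d, fun _ => ?e) => apply: scalar_omega_inv3; lin
      | (fun _ => ?d, _) => apply: scalar_omega_inv2; lin
      | _ => apply: scalar_omega_inv1; lin
      end
  | |- GRing.linear_for _ (fun x => @GRing.Linear.sort _ _ _ _ ?L (@?g x)) =>
      first [apply: (@linear_comp _ _ _ _ L); [by move=> ? ? ?; rewrite linearP|lin]
            |apply: (@scalar_comp _ _ _ L); [by move=> ? ? ?; rewrite linearP|lin]]
  | fl : GRing.linear_for _ ?f |- GRing.linear_for _ (fun x => ?f (@?g x)) =>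
      apply: (linear_comp fl); lin
  | |- GRing.linear_for _ (fun x => ?f (@?a x) (@?b x) (@?c x) (@?d x)) => is_var f;
      lazymatch constr:((a, b, (c, d))) with
      | (fun _ => ?a', fun _ => ?b', (fun _ => ?c', _)) => lin_hyp (f a' b' c') d
      | (fun _ => ?a', fun _ => ?b', (_, fun _ => ?d')) => lin_hyp (fun y => f a' b' y d') c
      | (fun _ => ?a', _, (fun _ => ?c', fun _ => ?d')) => lin_hyp (fun y => f a' y c' d') b
      | (_, fun _ => ?b', (fun _ => ?c', fun _ => ?d')) => lin_hyp (fun y => f y b' c' d') a
      end
  | |- GRing.linear_for _ (fun x => ?f (@?a x) (@?b x) (@?c x)) => is_var f;
      lazymatch constr:((a, b, c)) with
      | (fun _ => ?a', fun _ => ?b', _) => lin_hyp (f a' b') c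
      | (fun _ => ?a', _, fun _ => ?c') => lin_hyp (fun y => f a' y c') b
      | (_, fun _ => ?b', fun _ => ?c') => lin_hyp (fun y => f y b' c') a
      end
  | |- GRing.linear_for _ (fun x => ?f (@?a x) (@?b x)) => is_var f;
      lazymatch constr:((a, b)) with
      | (fun _ => ?a', _) => lin_hyp (f a') b
      | (_, fun _ => ?b') => lin_hyp (fun y => f y b') a
      end
  | |- GRing.linear_for _ _ => by move=> ? ? ?; rewrite linearP
  end.

(** In the tactics below env is the list of the variables that are the current
    legs, so that the position of a leg is its index in env. *)
Ltac index_of h env :=
  lazymatch env with
  | cons ?x ?e =>
      match constr:(Set) with
      | _ => let _ := match goal with _ => constr_eq x h end in constr:(Some 0%N)
      | _ => let r := index_of h e in
             lazymatch r with Some ?i => constr:(Some (S i)) | _ => r end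
      end
  | _ => constr:(@None nat)
  end.

Ltac split_at i x y env :=
  lazymatch env with
  | cons ?a ?e => lazymatch i with
     | S ?j => let e' := split_at j x y e in constr:(cons a e')
     | _ => constr:(cons x (cons y e))
     end
  end.

Ltac snoc s x :=
  lazymatch s with
  | cons ?a ?e => let r := snoc e x in constr:(cons a r)
  | _ => let T := type of x in constr:(cons x (@nil T))
  end.

(** Scalar factors may be grouped differently on the two sides. *)
Ltac leaf := cbv beta; first [reflexivity
  | rewrite ?scalerA; first [reflexivity | apply: (congr2 *:%R); [ring | reflexivity]]].

(** Moves the sum over t to the front; independent sums commute. *)
Ltac pull t :=
  lazymatch goal with
  | |- @tfold _ _ _ _ ?f ?t' = _ =>
    match constr:(Set) with
    | _ => let _ := match goal with _ =>
             lazymatch t with ?c ?h => lazymatch t' with ?c' ?h' => constr_eq h h' end end end in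
           reflexivity
    | _ => eapply etrans;
           [eapply eq_tfold; intros ? ?; cbv beta; pull t | eapply tfold_exchange]
    end
  | |- @GRing.scale _ _ ?c ?E = _ =>
      eapply etrans; [eapply (congr1 (GRing.scale c)); pull t | eapply scaler_tfold]
  end.

Ltac hoist :=
  lazymatch goal with
  | |- @tfold _ _ _ _ ?f ?t' = _ => reflexivity
  | |- @GRing.scale _ _ ?c ?E = _ =>
      eapply etrans; [eapply (congr1 (GRing.scale c)); hoist | eapply scaler_tfold]
  end.

(** Sums are brought to the order of the right-hand side one at a time, after
    which the summands agree up to their scalar factors. *)
Ltac sums_rec :=
  lazymatch goal with
  | |- _ = @tfold _ _ _ _ ?f ?t =>
      eapply etrans; [pull t | apply: eq_tfold; intros ? ?; cbv beta; sums_rec]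
  | |- _ = @GRing.scale _ _ ?c ?E =>
      first [ eapply etrans; [| eapply esym; hoist]; sums_rec | leaf ]
  | |- _ => leaf
  end.

Ltac sums := cbv [sweedler]; cbv beta; sums_rec.

(** The elements whose coproducts occur in E but that are not legs of another
    coproduct.  Variables bound by a coaction are skipped, as their coproducts
    are not part of the program. *)
Ltac sources E env all :=
  lazymatch E with
  | @tfold _ _ _ _ ?f (?c ?h) =>
      let T := type of h in
      lazymatch f with fun (_ : ?X) (_ : ?Y) => _ =>
      let x := fresh "x" in let y := fresh "y" in
      let r := lazymatch c with context [comul _] => index_of h env | _ => constr:(tt) end in
      lazymatch r with
      | None =>
          match constr:(Set) with
          | _ =>
            let _ := match goal with _ => is_var h end in
            let all' := snoc all h in
            let res := constr:(fun (x : X) (y : Y) => ltac:(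
              let E' := eval cbv beta in (f x y) in
              let r := sources E' (cons x (cons y (cons h env))) all' in exact r)) in
            lazymatch res with fun _ _ => ?r => r end
          | _ => all
          end
      | Some _ =>
          let res := constr:(fun (x : X) (y : Y) => ltac:(
            let E' := eval cbv beta in (f x y) in
            let r := sources E' (cons x (cons y env)) all in exact r)) in
          lazymatch res with fun _ _ => ?r => r end
      | _ =>
          let res := constr:(fun (x : X) (y : Y) => ltac:(
            let E' := eval cbv beta in (f x y) in
            let r := sources E' env all in exact r)) in
          match res with
          | fun _ _ => ?r => r
          | _ => all
          end
      end end
  | @GRing.scale _ _ _ ?E' => sources E' env all
  | _ => all
  end.

Ltac has_counit E x :=
  match E with context [@GRing.Linear.sort _ _ _ _ (@counit _ _) ?y] => constr_eq x y end.

(** The first n legs to which the scalars in E apply a counit, in the indexing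
    convention of [drops]. *)
Ltac counit_positions n i E env :=
  lazymatch n with
  | S ?n' =>
      lazymatch env with
      | cons ?x ?e =>
        match constr:(Set) with
        | _ => let _ := match goal with _ => has_counit E x end in
               let js := counit_positions n' i E e in constr:(cons i js)
        | _ => counit_positions n (S i) E e
        end
      end
  | _ => constr:(@nil nat)
  end.

(** The coproducts may be interleaved with other sums and with scalars; acc
    collects the scalars, among which the counits are looked for. *)
Ltac reify n acc E env :=
  lazymatch E with
  | @tfold _ _ _ _ ?f (?c ?h) =>
      lazymatch f with fun (_ : ?X) (_ : ?Y) => _ =>
      let x := fresh "x" in let y := fresh "y" in
      let r := lazymatch c with context [comul _] => index_of h env | _ => constr:(tt) end in
      let res := constr:(fun (x : X) (y : Y) => ltac:(
            let E' := eval cbv beta in (f x y) in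
            let env' := lazymatch r with Some ?i => split_at i x y env | _ => env end in
            let r := reify n acc E' env' in exact r)) in
      lazymatch res with
      | fun _ _ => (?p, ?js) =>
        lazymatch r with Some ?i => constr:((cons i p, js)) | _ => constr:((p, js)) end
      end end
  | @GRing.scale _ _ ?c ?E' =>
      let acc' := constr:((acc, c)) in reify n acc' E' env
  | _ => let js := counit_positions n 0%N acc env in constr:((@nil nat, js))
  end.

Ltac abstract_env E env :=
  lazymatch env with
  | cons ?x ?e =>
      let b := abstract_env E e in
      let b := eval pattern x in b in
      lazymatch b with ?f _ => f end
  | _ => E
  end.

(** On the right-hand side of a goal the coproducts come first; the rest, as a
    function of the legs, is the multilinear expression to be regrouped. *)
Ltac reify_head E env :=
  lazymatch E with
  | @tfold _ _ _ _ ?f (?c ?h) =>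
      lazymatch f with fun (_ : ?X) (_ : ?Y) => _ =>
      let x := fresh "x" in let y := fresh "y" in
      let r := lazymatch c with context [comul _] => index_of h env | _ => constr:(tt) end in
      lazymatch r with
      | Some ?i =>
        let res := constr:(fun (x : X) (y : Y) => ltac:(
            let E' := eval cbv beta in (f x y) in
            let env' := split_at i x y env in
            let r := reify_head E' env' in exact r)) in
        lazymatch res with
        | fun _ _ => (?p, ?b) => constr:((cons i p, b))
        end
      | _ => let b := abstract_env E env in constr:((@nil nat, b))
      end end
  | _ => let b := abstract_env E env in constr:((@nil nat, b))
  end.

(** Proves an equality that only involves coassociativity, counits, and the
    rearrangement of sums and scalars.  Coproducts must come first on the
    right-hand side, and may be anywhere on the left-hand side. *)
Ltac regroup :=
  cbv [sweedler]; cbv beta;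
  lazymatch goal with |- @eq _ ?L ?R =>
    let T := match goal with |- context [@tfold _ _ _ _ _ (?c ?h)] =>
      lazymatch c with context [comul _] => type of h end end in
    let C := match goal with |- context [@comul ?k ?C] => constr:(@regroup_legs k C) end in
    let src := sources L (@nil T) (@nil T) in
    let src := sources R src src in
    let rR := reify_head R src in
    lazymatch rR with (?pR, ?f) =>
    let pL := reify 0%N tt L src in
    let pL := eval cbv [fst] in (fst pL) in
    let n := eval vm_compute in (size pL - size pR)%N in
    let m := eval vm_compute in (size pR + size src)%N in
    let r := reify n tt L src in
    let js := eval cbv [snd] in (snd r) in
    let E := fresh "E" in
    pose proof (C _ m src pL js pR f) as E;
    cbv [run cop_at counits counit_at uncurry foldr] in E; cbv beta in E;
    eapply etrans;
      [| eapply E; [vm_compute; reflexivity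
              | cbv [multilinear_legs linear_legs]; cbv beta; repeat split; lin]];
    clear E; sums_rec
  end end.

(** * Identities in a coquasi-Hopf algebra *)

Local Notation "h ∙ g" := (hmul h g) (at level 40, left associativity).
Local Notation "'1H'" := (cq_one _).
Local Notation ω := omega.
Local Notation ω' := omega_inv.
Local Notation ε := (counit _).
Local Notation S := (antipode _).
Local Notation α := (alpha _).
Local Notation β := (beta _).

Ltac push_vector :=
  first [rewrite tfold_scaler; apply: eq_tfold => ? ?; cbv beta; push_vector | reflexivity].

(** Identities between scalars are used with a vector u as right factor, which
    lets them apply inside expressions with values in any space. *)
Ltac scaled ax u :=
  etransitivity; [| etransitivity; [exact: (congr1 (fun c => c *: u) ax) |]]; cbv [sweedler];
  [symmetry; push_vector | push_vector].

(** Rewriting below n sums, counting one for each coproduct or coaction. *)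
Ltac under_legs n tac :=
  etransitivity; [do n! (apply: eq_tfold => ? ?); cbv [sweedler]; tac; reflexivity | cbv beta].

Ltac legs n lem :=
  etransitivity; [do n! (apply: eq_tfold => ? ?); cbv beta; exact: lem | cbv beta].

Section Coquasi.
Variables (k : fieldType) (H : coquasi_Hopf k).
Implicit Types (h g l m x y z : H).

Lemma eq_scalars (a b : k) : (forall (U : lmodType k) (u : U), a *: u = b *: u) -> a = b.
Proof. by move=> /(_ k^o 1); rewrite /GRing.scale /= !mulr1. Qed.

Section Vectors.
Variable U : lmodType k.
Implicit Types u : U.

Lemma comul_hmul (F : H -> H -> U) h g :
  (forall y, linear (fun x => F x y)) -> (forall x, linear (fun y => F x y)) ->
  Δ[x, y <- h ∙ g] F x y =
  Δ[h1, h2 <- h] Δ[g1, g2 <- g] F (h1 ∙ g1) (h2 ∙ g2).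
Proof.
move=> F1 F2; rewrite (cq_mul_comul (cqH_bialgebra H)) /sweedler tfold_tfold //.
apply: eq_tfold => h1 h2; rewrite tfold_tfold //.
by apply: eq_tfold => g1 g2; rewrite tfold_pure.
Qed.

Lemma comul_one (F : H -> H -> U) :
  (forall y, linear (fun x => F x y)) -> (forall x, linear (fun y => F x y)) ->
  Δ[x, y <- cq_one H] F x y = F 1H 1H.
Proof.
by move=> F1 F2; rewrite (cq_one_comul (cqH_bialgebra H)) tfold_pure.
Qed.

Lemma comul_antipode (F : H -> H -> U) h :
  (forall y, linear (fun x => F x y)) -> (forall x, linear (fun y => F x y)) ->
  Δ[x, y <- antipode H h] F x y = Δ[h1, h2 <- h] F (S h2) (S h1).
Proof.
move=> F1 F2; rewrite (cq_anti_comul (cqH_antipode H)) /sweedler tfold_tfold //.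
by apply: eq_tfold => h1 h2; rewrite tfold_pure.
Qed.

Lemma omegaV h g l u :
  Δ[h1, h2 <- h] Δ[g1, g2 <- g] Δ[l1, l2 <- l] (ω h1 g1 l1 * ω' h2 g2 l2) *: u =
  (ε h * ε g * ε l) *: u.
Proof. scaled (cq_omegaV (cqH_bialgebra H) h g l) u. Qed.

Lemma omegaVl h g l u :
  Δ[h1, h2 <- h] Δ[g1, g2 <- g] Δ[l1, l2 <- l] (ω' h1 g1 l1 * ω h2 g2 l2) *: u =
  (ε h * ε g * ε l) *: u.
Proof. scaled (cq_omegaVl (cqH_bialgebra H) h g l) u. Qed.

Lemma cocycle h g l m u :
  sweedler 1 h (fun h1 h2 => sweedler 1 g (fun g1 g2 =>
    sweedler 1 l (fun l1 l2 => sweedler 1 m (fun m1 m2 =>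
      (ω h1 g1 (l1 ∙ m1) * ω (h2 ∙ g2) l2 m2) *: u)))) =
  sweedler 1 h (fun h1 h2 => sweedler 2 g (fun g1 g2 g3 =>
    sweedler 2 l (fun l1 l2 l3 => sweedler 1 m (fun m1 m2 =>
      (ω g1 l1 m1 * ω h1 (g2 ∙ l2) m2 * ω h2 g3 l3) *: u)))).
Proof. scaled (cq_cocycle (cqH_bialgebra H) h g l m) u. Qed.

End Vectors.

Lemma omega1 h g : ω h (cq_one H) g = ε h * ε g.
Proof. exact: (cq_omega1 (cqH_bialgebra H)). Qed.

Lemma counit_one : ε (cq_one H) = 1.
Proof. exact: (cq_one_counit (cqH_bialgebra H)). Qed.

Lemma hmul1l h : cq_one H ∙ h = h.
Proof. exact: (cq_mul1l (cqH_bialgebra H)). Qed.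

Lemma hmul1r h : h ∙ cq_one H = h.
Proof. exact: (cq_mul1r (cqH_bialgebra H)). Qed.

Lemma counit_hmul h g : ε (h ∙ g) = ε h * ε g.
Proof. exact: (cq_mul_counit (cqH_bialgebra H)). Qed.

Lemma counit_antipode h : ε (antipode H h) = ε h.
Proof. exact: (cq_anti_counit (cqH_antipode H)). Qed.

Lemma omega_inv_mid1 h g : ω' h (cq_one H) g = ε h * ε g.
Proof.
apply: eq_scalars => U u; have := omegaV h (cq_one H) g u.
rewrite counit_one mulr1 => <-.
transitivity (Δ[h1, h2 <- h] Δ[l1, l2 <- g] (ε h1 * ε l1 * ω' h2 1H l2) *: u).
  by symmetry; regroup.
apply: eq_tfold => h1 h2; rewrite comul_one; first by apply: eq_tfold => l1 l2; rewrite omega1.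
all: lin.
Qed.

(** In the convolution algebra of bilinear forms, f = (f' f) f = f' (f f) = f' f
    when f is idempotent. *)
Lemma convolution_idempotent (f f' : H -> H -> k) :
  (forall y, scalar (fun x => f x y)) -> (forall x, scalar (fun y => f x y)) ->
  (forall y, scalar (fun x => f' x y)) -> (forall x, scalar (fun y => f' x y)) ->
  (forall (U : lmodType k) (u : U) g l,
     Δ[g1, g2 <- g] Δ[l1, l2 <- l] (f g1 l1 * f g2 l2) *: u = f g l *: u) ->
  (forall (U : lmodType k) (u : U) g l,
     Δ[g1, g2 <- g] Δ[l1, l2 <- l] (f' g1 l1 * f g2 l2) *: u = (ε g * ε l) *: u) ->
  forall g l, f g l = ε g * ε l.
Proof.
move=> fl fr f'l f'r ff f'f g l; apply: eq_scalars => U u.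
transitivity (Δ[x, g3 <- g] Δ[z, l3 <- l] (Δ[g1, g2 <- x] Δ[l1, l2 <- z]
   (f' g1 l1 * f g2 l2) *: (f g3 l3 *: u))).
  by symmetry; under_legs 2%N ltac:(rewrite f'f); regroup.
transitivity (sweedler 2 g (fun g1 g2 g3 => sweedler 2 l (fun l1 l2 l3 =>
    (f' g1 l1 * f g2 l2 * f g3 l3) *: u))).
  by regroup.
transitivity (Δ[g1, x <- g] Δ[l1, z <- l] f' g1 l1 *: (Δ[g2, g3 <- x] Δ[l2, l3 <- z]
   (f g2 l2 * f g3 l3) *: u)).
  by symmetry; regroup.
under_legs 2%N ltac:(rewrite ff).
by rewrite -f'f; sums.
Qed.

(** The cocycle identity with first two entries 1 says that ω(1,-,-) is
    idempotent. *)
Lemma omega_left1 g l : ω (cq_one H) g l = ε g * ε l.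
Proof.
move: g l; apply: (@convolution_idempotent _ (ω' (cq_one H))) => [*|*|*|*|U u g l|U u g l].
1-4: lin.
- have := cocycle (cq_one H) 1H g l u; rewrite /sweedler !comul_one; try lin.
  move=> e; transitivity (Δ[g1, g2 <- g] Δ[l1, l2 <- l]
      (ω (cq_one H) 1H (g1 ∙ l1) * ω (cq_one H ∙ 1H) g2 l2) *: u).
    rewrite e; symmetry.
    by under_legs 3%N ltac:(rewrite omega1 hmul1l counit_one mul1r); regroup.
  by under_legs 2%N ltac:(rewrite omega1 counit_one counit_hmul hmul1l mul1r); regroup.
- have := omegaVl (cq_one H) g l u.
  by rewrite !comul_one ?counit_one ?mul1r; try lin.
Qed.

(** The same with the last two entries. *)
Lemma omega_right1 h g : ω h g (cq_one H) = ε h * ε g.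
Proof.
move: h g.
apply: (@convolution_idempotent _ (fun h g => ω' h g (cq_one H))) => [*|*|*|*|U u h g|U u h g].
1-4: lin.
- etransitivity; [|etransitivity; [exact: (esym (cocycle h g (cq_one H) (cq_one H) u))|]];
    rewrite /sweedler.
  + symmetry; under_legs 3%N ltac:(rewrite !comul_one; try lin).
    by under_legs 3%N ltac:(rewrite hmul1r omega1 counit_one mulr1); regroup.
  + under_legs 2%N ltac:(rewrite !comul_one; try lin).
    by under_legs 2%N ltac:(rewrite hmul1l omega1 counit_one mulr1 counit_hmul); regroup.
- have := omegaVl h g (cq_one H) u; rewrite counit_one mulr1 => <-.
  by symmetry; under_legs 2%N ltac:(rewrite comul_one; try lin).
Qed.

Lemma omega_inv_left1 g l : ω' (cq_one H) g l = ε g * ε l.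
Proof.
apply: eq_scalars => U u; have := omegaV (cq_one H) g l u.
rewrite counit_one mul1r => <-.
transitivity (Δ[h1, h2 <- g] Δ[l1, l2 <- l] (ε h1 * ε l1 * ω' 1H h2 l2) *: u).
  by symmetry; regroup.
rewrite comul_one; try lin.
by under_legs 2%N ltac:(rewrite -omega_left1).
Qed.

(** The cocycle identity multiplied by ω^-1(h,g,ml) on the left and by the
    inverses of ω(h,g,m) and ω(h,gm,l) on the right.  This is the form met when
    an evaluation follows a transposition or a composition. *)
Lemma pentagon_left h g m l (U : lmodType k) (u : U) :
  sweedler 1 g (fun g1 g2 => sweedler 1 m (fun m1 m2 => sweedler 1 l (fun l1 l2 =>
     (ω' h g1 (m1 ∙ l1) * ω g2 m2 l2) *: u))) =
  sweedler 2 h (fun h1 h2 h3 => sweedler 2 g (fun g1 g2 g3 =>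
    sweedler 2 m (fun m1 m2 m3 => sweedler 1 l (fun l1 l2 =>
      (ω (h1 ∙ g1) m1 l1 * ω' h2 g2 m2 * ω' h3 (g3 ∙ m3) l2) *: u)))).
Proof.
symmetry.
(* the counits inserted here are expanded as ω^-1 ω at (x, y, z w) *)
transitivity (Δ[x, h' <- h] Δ[y, g' <- g] Δ[z, m' <- m] Δ[w, l' <- l]
  (ε x * ε y * ε (z ∙ w)) *:
  sweedler 2 h' (fun h1 h2 h3 => sweedler 2 g' (fun g1 g2 g3 =>
    sweedler 2 m' (fun m1 m2 m3 => sweedler 1 l' (fun l1 l2 =>
      (ω (h1 ∙ g1) m1 l1 * ω' h2 g2 m2 * ω' h3 (g3 ∙ m3) l2) *: u))))).
  by symmetry; under_legs 4%N ltac:(rewrite counit_hmul); regroup.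
under_legs 4%N ltac:(rewrite -omegaVl).
under_legs 4%N ltac:(do 2!(apply: eq_tfold => ? ?); rewrite comul_hmul; try lin).
transitivity (
  sweedler 4 h (fun h1 h2 h3 h4 h5 => sweedler 4 g (fun g1 g2 g3 g4 g5 =>
    sweedler 4 m (fun m1 m2 m3 m4 m5 => sweedler 3 l (fun l1 l2 l3 l4 =>
      (ω' h1 g1 (m1 ∙ l1) * (ω h2 g2 (m2 ∙ l2) * ω (h3 ∙ g3) m3 l3) *
       ω' h4 g4 m4 * ω' h5 (g5 ∙ m5) l4) *: u))))).
  by regroup.
(* the middle legs are those of the cocycle identity *)
transitivity (
  sweedler 3 h (fun h1 x h4 h5 => sweedler 3 g (fun g1 y g4 g5 =>
    sweedler 3 m (fun m1 z m4 m5 => sweedler 2 l (fun l1 w l4 =>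
    sweedler 1 x (fun h2 h3 => sweedler 1 y (fun g2 g3 =>
    sweedler 1 z (fun m2 m3 => sweedler 1 w (fun l2 l3 =>
      (ω h2 g2 (m2 ∙ l2) * ω (h3 ∙ g3) m3 l3) *:
      ((ω' h1 g1 (m1 ∙ l1) * ω' h4 g4 m4 * ω' h5 (g5 ∙ m5) l4) *: u)))))))))).
  by symmetry; regroup.
legs 11%N cocycle.
transitivity (
  sweedler 3 h (fun h1 h2 x h5 => sweedler 4 g (fun g1 g2 g3 y g6 =>
    sweedler 4 m (fun m1 m2 m3 z m6 => sweedler 3 l (fun l1 l2 l3 l4 =>
    sweedler 1 x (fun h3 h4 => sweedler 1 y (fun g4 g5 => sweedler 1 z (fun m4 m5 =>
      (ω h3 g4 m4 * ω' h4 g5 m5) *: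
      ((ω' h1 g1 (m1 ∙ l1) * ω g2 m2 l2 * ω h2 (g3 ∙ m3) l3 * ω' h5 (g6 ∙ m6) l4) *: u))))))))).
  transitivity (
    sweedler 4 h (fun h1 h2 h3 h4 h5 => sweedler 5 g (fun g1 g2 g3 g4 g5 g6 =>
    sweedler 5 m (fun m1 m2 m3 m4 m5 m6 => sweedler 3 l (fun l1 l2 l3 l4 =>
      (ω' h1 g1 (m1 ∙ l1) * ω g2 m2 l2 * ω h2 (g3 ∙ m3) l3 * ω h3 g4 m4 * ω' h4 g5 m5 *
       ω' h5 (g6 ∙ m6) l4) *: u))))).
    by regroup.
  by symmetry; regroup.
legs 14%N omegaV.
transitivity (
  Δ[h1, x <- h] sweedler 2 g (fun g1 g2 y =>
    sweedler 2 m (fun m1 m2 z => sweedler 2 l (fun l1 l2 w =>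
    Δ[h2, h5 <- x] Δ[g3, g6 <- y] Δ[m3, m6 <- z] Δ[l3, l4 <- w]
      (ω h2 (g3 ∙ m3) l3 * ω' h5 (g6 ∙ m6) l4) *:
      ((ω' h1 g1 (m1 ∙ l1) * ω g2 m2 l2) *: u))))).
  transitivity (
    sweedler 2 h (fun h1 h2 h5 => sweedler 3 g (fun g1 g2 g3 g6 =>
    sweedler 3 m (fun m1 m2 m3 m6 => sweedler 3 l (fun l1 l2 l3 l4 =>
      (ω' h1 g1 (m1 ∙ l1) * ω g2 m2 l2 * ω h2 (g3 ∙ m3) l3 * ω' h5 (g6 ∙ m6) l4) *: u))))).
    by regroup.
  by symmetry; regroup.
transitivity (
  Δ[h1, x <- h] sweedler 2 g (fun g1 g2 y =>
    sweedler 2 m (fun m1 m2 z => sweedler 2 l (fun l1 l2 w =>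
    (ε x * ε (y ∙ z) * ε w) *: ((ω' h1 g1 (m1 ∙ l1) * ω g2 m2 l2) *: u))))).
  do 7! apply: eq_tfold => ? ?; rewrite -omegaV.
  apply: eq_tfold => ? ?; rewrite comul_hmul; try lin.
  by [].
by under_legs 7%N ltac:(rewrite counit_hmul); regroup.
Qed.

End Coquasi.

Ltac push_map fl := first
  [ rewrite (tfold_map _ _ fl); apply: eq_tfold => ? ?; cbv beta; push_map fl
  | rewrite (linear_valZ _ _ fl); reflexivity
  | reflexivity].

Section Coquasi.
Variables (k : fieldType) (H : coquasi_Hopf k).
Implicit Types (h g l m x y z : H).

(** The cocycle identity multiplied by ω^-1(g,m,l) on the left and by
    ω^-1(hg,m,l) on the right, for a coevaluation followed by an evaluation. *)
Lemma pentagon_right h g m l (U : lmodType k) (u : U) :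
  sweedler 1 g (fun g1 g2 => sweedler 1 m (fun m1 m2 => sweedler 1 l (fun l1 l2 =>
     (ω' g1 m1 l1 * ω h g2 (m2 ∙ l2)) *: u))) =
  sweedler 2 h (fun h1 h2 h3 => sweedler 2 g (fun g1 g2 g3 =>
    sweedler 2 m (fun m1 m2 m3 => sweedler 1 l (fun l1 l2 =>
      (ω h1 (g1 ∙ m1) l1 * ω h2 g2 m2 * ω' (h3 ∙ g3) m3 l2) *: u)))).
Proof.
(* the counits inserted here are expanded as ω ω^-1 at (x y, z, w) *)
transitivity (Δ[h1, x <- h] sweedler 2 g (fun g1 g2 y =>
  sweedler 2 m (fun m1 m2 z => sweedler 2 l (fun l1 l2 w =>
    (ε (x ∙ y) * ε z * ε w) *: ((ω' g1 m1 l1 * ω h1 g2 (m2 ∙ l2)) *: u))))).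
  by symmetry; under_legs 7%N ltac:(rewrite counit_hmul); regroup.
under_legs 7%N ltac:(rewrite -omegaV comul_hmul; try lin).
transitivity (
  sweedler 2 h (fun h1 h2 h3 => sweedler 3 g (fun g1 g2 g3 g4 =>
    sweedler 3 m (fun m1 m2 m3 m4 => sweedler 3 l (fun l1 l2 l3 l4 =>
      (ω' g1 m1 l1 * ω h1 g2 (m2 ∙ l2) * ω (h2 ∙ g3) m3 l3 * ω' (h3 ∙ g4) m4 l4) *: u))))).
  by regroup.
transitivity (
  sweedler 1 h (fun x h3 => sweedler 2 g (fun g1 y g4 =>
    sweedler 2 m (fun m1 z m4 => sweedler 2 l (fun l1 w l4 =>
    sweedler 1 x (fun h1 h2 => sweedler 1 y (fun g2 g3 =>
    sweedler 1 z (fun m2 m3 => sweedler 1 w (fun l2 l3 =>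
      (ω h1 g2 (m2 ∙ l2) * ω (h2 ∙ g3) m3 l3) *:
      ((ω' g1 m1 l1 * ω' (h3 ∙ g4) m4 l4) *: u)))))))))).
  by symmetry; regroup.
legs 7%N cocycle.
transitivity (
  sweedler 2 h (fun h1 h2 h3 => sweedler 4 g (fun g1 g2 g3 g4 g5 =>
    sweedler 4 m (fun m1 m2 m3 m4 m5 => sweedler 3 l (fun l1 l2 l3 l4 =>
      (ω' g1 m1 l1 * ω g2 m2 l2 * ω h1 (g3 ∙ m3) l3 * ω h2 g4 m4 * ω' (h3 ∙ g5) m5 l4) *: u))))).
  by regroup.
transitivity (
  sweedler 2 h (fun h1 h2 h3 => sweedler 3 g (fun y g3 g4 g5 =>
    sweedler 3 m (fun z m3 m4 m5 => sweedler 2 l (fun w l3 l4 =>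
      Δ[g1, g2 <- y] Δ[m1, m2 <- z] Δ[l1, l2 <- w] (ω' g1 m1 l1 * ω g2 m2 l2) *:
      ((ω h1 (g3 ∙ m3) l3 * ω h2 g4 m4 * ω' (h3 ∙ g5) m5 l4) *: u)))))).
  by symmetry; regroup.
legs 10%N omegaVl.
by regroup.
Qed.

Lemma hmulA (U : lmodType k) (Ψ : H -> U) h g l : linear Ψ ->
  Δ[h1, h2 <- h] Δ[g1, g2 <- g] Δ[l1, l2 <- l] ω h2 g2 l2 *: Ψ (h1 ∙ (g1 ∙ l1)) =
  Δ[h1, h2 <- h] Δ[g1, g2 <- g] Δ[l1, l2 <- l] ω h1 g1 l1 *: Ψ (h2 ∙ g2 ∙ l2).
Proof.
move=> Ψl; have /(congr1 Ψ) := cq_mulA (cqH_bialgebra H) h g l.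
rewrite /sweedler => e; etransitivity; [|etransitivity; [exact: e|]].
  by symmetry; push_map Ψl.
by push_map Ψl.
Qed.

(** Quasi-associativity, convolved with ω^-1 on both sides. *)
Lemma hmulA_inv (U : lmodType k) (Ψ : H -> U) h g l : linear Ψ ->
  sweedler 1 h (fun h1 h2 => sweedler 1 g (fun g1 g2 => sweedler 1 l (fun l1 l2 =>
    ω' h1 g1 l1 *: Ψ (h2 ∙ (g2 ∙ l2))))) =
  sweedler 1 h (fun h1 h2 => sweedler 1 g (fun g1 g2 => sweedler 1 l (fun l1 l2 =>
    ω' h2 g2 l2 *: Ψ (h1 ∙ g1 ∙ l1)))).
Proof.
move=> Ψl.
transitivity (sweedler 2 h (fun h1 h2 x => sweedler 2 g (fun g1 g2 y =>
  sweedler 2 l (fun l1 l2 z =>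
    (ε x * ε y * ε z) *: (ω' h1 g1 l1 *: Ψ (h2 ∙ (g2 ∙ l2))))))).
  by symmetry; regroup.
under_legs 6%N ltac:(rewrite -omegaV).
transitivity (sweedler 3 h (fun h1 h2 h3 h4 => sweedler 3 g (fun g1 g2 g3 g4 =>
  sweedler 3 l (fun l1 l2 l3 l4 =>
    (ω' h1 g1 l1 * ω' h4 g4 l4) *: (ω h3 g3 l3 *: Ψ (h2 ∙ (g2 ∙ l2))))))).
  by regroup.
transitivity (sweedler 2 h (fun h1 x h4 => sweedler 2 g (fun g1 y g4 =>
  sweedler 2 l (fun l1 z l4 =>
    (ω' h1 g1 l1 * ω' h4 g4 l4) *: (Δ[h2, h3 <- x] Δ[g2, g3 <- y] Δ[l2, l3 <- z]
       ω h3 g3 l3 *: Ψ (h2 ∙ (g2 ∙ l2))))))).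
  by symmetry; regroup.
under_legs 6%N ltac:(rewrite hmulA //).
transitivity (sweedler 3 h (fun h1 h2 h3 h4 => sweedler 3 g (fun g1 g2 g3 g4 =>
  sweedler 3 l (fun l1 l2 l3 l4 =>
    (ω' h1 g1 l1 * ω h2 g2 l2 * ω' h4 g4 l4) *: Ψ (h3 ∙ g3 ∙ l3))))).
  by regroup.
transitivity (sweedler 2 h (fun x h3 h4 => sweedler 2 g (fun y g3 g4 =>
  sweedler 2 l (fun z l3 l4 =>
    Δ[h1, h2 <- x] Δ[g1, g2 <- y] Δ[l1, l2 <- z]
     (ω' h1 g1 l1 * ω h2 g2 l2) *: (ω' h4 g4 l4 *: Ψ (h3 ∙ g3 ∙ l3)))))).
  by symmetry; regroup.
legs 6%N omegaVl.
by regroup.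
Qed.

Lemma antipode_alpha (U : lmodType k) (Ψ : H -> U) h : linear Ψ ->
  Δ[h1, y <- h] Δ[h2, h3 <- y] α h2 *: Ψ (S h1 ∙ h3) = α h *: Ψ 1H.
Proof.
move=> Ψl; rewrite -(linear_valZ _ _ Ψl) -(cq_anti_alpha (cqH_antipode H)).
by symmetry; push_map Ψl.
Qed.

Lemma antipode_beta (U : lmodType k) (Ψ : H -> U) h : linear Ψ ->
  Δ[h1, y <- h] Δ[h2, h3 <- y] β h2 *: Ψ (h1 ∙ S h3) = β h *: Ψ 1H.
Proof.
move=> Ψl; rewrite -(linear_valZ _ _ Ψl) -(cq_anti_beta (cqH_antipode H)).
by symmetry; push_map Ψl.
Qed.

Lemma zigzag (U : lmodType k) (u : U) h :
  sweedler 4 h (fun h1 h2 h3 h4 h5 => (ω h1 (S h3) h5 * β h2 * α h4) *: u) = ε h *: u.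
Proof. scaled (cq_anti_omega (cqH_antipode H) h) u. Qed.

Lemma zigzag_inv (U : lmodType k) (u : U) h :
  sweedler 4 h (fun h1 h2 h3 h4 h5 => (ω' (S h1) h3 (S h5) * α h2 * β h4) *: u) = ε h *: u.
Proof. scaled (cq_anti_omega_inv (cqH_antipode H) h) u. Qed.

End Coquasi.

(** * Comodule algebras and the category of kernels *)

Local Notation "'ρ[' x , y <- a ] E" := (tfold (fun x y => E) (coact _ a))
  (at level 40, x name, y name, a at level 200, E at level 40).
Local Notation "a ⋆ b" := (amul a b) (at level 40, left associativity).
Local Notation "'1A'" := (ca_one _).

Section ComoduleAlgebra.
Variables (k : fieldType) (H : coquasi_Hopf k) (A : comodule_algebra H).
Implicit Types (h : H).

Section Vectors.
Variable U : lmodType k.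

(** Iterated coactions are always rewritten with the coproducts on the right:
    a single leg in A, then the legs of one element of H. *)
Lemma coactA (F : A -> H -> H -> U) (a : A) :
  (forall y z, linear (fun x => F x y z)) -> (forall x z, linear (fun y => F x y z)) ->
  (forall x y, linear (fun z => F x y z)) ->
  ρ[x, a2 <- a] ρ[a0, a1 <- x] F a0 a1 a2 = ρ[a0, l <- a] Δ[a1, a2 <- l] F a0 a1 a2.
Proof.
move=> F1 F2 F3.
pose T x (t : (H ⊗ H)%type) := tfold (F x) t.
have Tl x : linear (T x) by apply: tfold_linear.
have Tr t : linear (fun x => T x t) by apply: linear_tfold_body => v w; apply: F1.
have /(congr1 (tfold T)) := ca_coactA (ca_axioms A) a; rewrite !tfold_tfold // => e.
transitivity (tfold (fun a0 a1 => tfold T (a0 ⊗ comul H a1)) (coact A a)).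
  rewrite e; apply: eq_tfold => x a2; rewrite tfold_tfold //.
  by apply: eq_tfold => a0 a1; rewrite tfold_pure // /T tfold_pure.
by apply: eq_tfold => a0 l; rewrite tfold_pure.
Qed.

Lemma coact_counit (G : A -> U) (a : A) : linear G -> ρ[a0, a1 <- a] ε a1 *: G a0 = G a.
Proof.
move=> Gl; rewrite -[in RHS](ca_coact_counit (ca_axioms A) a).
by symmetry; push_map Gl.
Qed.

Lemma coact_amul (F : A -> H -> U) (a b : A) :
  (forall y, linear (fun x => F x y)) -> (forall x, linear (fun y => F x y)) ->
  ρ[c0, c1 <- a ⋆ b] F c0 c1 = ρ[a0, a1 <- a] ρ[b0, b1 <- b] F (a0 ⋆ b0) (a1 ∙ b1).
Proof.
move=> F1 F2; rewrite (ca_mul_coact (ca_axioms A)) tfold_tfold //.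
apply: eq_tfold => a0 a1; rewrite tfold_tfold //.
by apply: eq_tfold => b0 b1; rewrite tfold_pure.
Qed.

Lemma coact_one (F : A -> H -> U) :
  (forall y, linear (fun x => F x y)) -> (forall x, linear (fun y => F x y)) ->
  ρ[c0, c1 <- ca_one A] F c0 c1 = F 1A 1H.
Proof. by move=> F1 F2; rewrite (ca_one_coact (ca_axioms A)) tfold_pure. Qed.

Lemma coact_coact_amul (W : H -> H -> A -> H -> U) (a b : A) :
  (forall y z t, linear (fun x => W x y z t)) -> (forall x z t, linear (fun y => W x y z t)) ->
  (forall x y t, linear (fun z => W x y z t)) -> (forall x y z, linear (fun t => W x y z t)) ->
  ρ[a0, a1 <- a] ρ[b0, b1 <- b] ρ[c0, c1 <- a0 ⋆ b0] W a1 b1 c0 c1 =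
  ρ[a0, l <- a] ρ[b0, m <- b] Δ[l1, l2 <- l] Δ[m1, m2 <- m] W l2 m2 (a0 ⋆ b0) (l1 ∙ m1).
Proof.
move=> W1 W2 W3 W4.
under_legs 2%N ltac:(rewrite coact_amul; try lin).
transitivity (ρ[x, a2 <- a] ρ[a0, a1 <- x] (ρ[y, b2 <- b] ρ[b0, b1 <- y]
  W a2 b2 (a0 ⋆ b0) (a1 ∙ b1))); first by sums.
under_legs 2%N ltac:(rewrite coactA; try lin).
rewrite coactA; try lin.
by sums.
Qed.

Lemma amul_assoc (L : A -> U) (a b c : A) : linear L ->
  L (a ⋆ b ⋆ c) =
  ρ[a0, a1 <- a] ρ[b0, b1 <- b] ρ[c0, c1 <- c] ω a1 b1 c1 *: L (a0 ⋆ (b0 ⋆ c0)).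
Proof. by move=> Ll; rewrite (ca_mulA (ca_axioms A)); push_map Ll. Qed.

Lemma coact_amul_assoc (W : H -> H -> H -> A -> U) (a b c : A) :
  (forall y z t, linear (fun x => W x y z t)) -> (forall x z t, linear (fun y => W x y z t)) ->
  (forall x y t, linear (fun z => W x y z t)) -> (forall x y z, linear (fun t => W x y z t)) ->
  ρ[a0, l <- a] ρ[b0, m <- b] ρ[c0, n <- c] W l m n (a0 ⋆ b0 ⋆ c0) =
  ρ[a0, l <- a] ρ[b0, m <- b] ρ[c0, n <- c] Δ[l1, l2 <- l] Δ[m1, m2 <- m] Δ[n1, n2 <- n]
    ω l1 m1 n1 *: W l2 m2 n2 (a0 ⋆ (b0 ⋆ c0)).
Proof.
move=> W1 W2 W3 W4.
under_legs 3%N ltac:(rewrite amul_assoc //).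
transitivity (ρ[x, a2 <- a] ρ[a0, a1 <- x] (ρ[y, b2 <- b] ρ[b0, b1 <- y]
  (ρ[z, c2 <- c] ρ[c0, c1 <- z]  ω a1 b1 c1 *: W a2 b2 c2 (a0 ⋆ (b0 ⋆ c0))))).
  by sums.
under_legs 4%N ltac:(rewrite coactA; try lin).
under_legs 2%N ltac:(rewrite coactA; try lin).
rewrite coactA; try lin.
by sums.
Qed.

End Vectors.

Lemma amul1l (a : A) : ca_one A ⋆ a = a. Proof. exact: (ca_mul1l (ca_axioms A)). Qed.
Lemma amul1r (a : A) : a ⋆ ca_one A = a. Proof. exact: (ca_mul1r (ca_axioms A)). Qed.

(** The comodules H_σ to which the spaces of the context refer are indexed by
    these maps. *)
Record coalgebra_map (σ : H -> H) : Prop := {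
  map_linear : linear σ;
  map_comul : forall h, comul H (σ h) = Δ[h1, h2 <- h] (σ h1 ⊗ σ h2);
  map_counit : forall h, ε (σ h) = ε h
}.

Lemma comul_map (U : lmodType k) (F : H -> H -> U) σ h (σm : coalgebra_map σ) :
  (forall y, linear (fun x => F x y)) -> (forall x, linear (fun y => F x y)) ->
  Δ[x, y <- σ h] F x y = Δ[h1, h2 <- h] F (σ h1) (σ h2).
Proof.
move=> F1 F2; rewrite (map_comul σm) tfold_tfold //.
by apply: eq_tfold => h1 h2; rewrite tfold_pure.
Qed.

(** Right colinearity of h |-> h1 ⊗ f(h2) as a map H_σ -> H_τ ⊗ A, after the
    first leg has been removed by the counit. *)
Definition is_kernel (σ τ : H -> H) (f : H -> A) : Prop := linear f /\ forall h,
  Δ[h1, h2 <- h] ρ[a0, a1 <- f h2] (a0 ⊗ (τ h1 ∙ a1)) = Δ[h1, h2 <- h] (f h1 ⊗ σ h2).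

(** The form in which colinearity is used: an occurrence of τ(h1) multiplied by
    the coaction of f(h2) is replaced by σ of the next leg. *)
Lemma kernelE (U : lmodType k) (G : A -> H -> H -> U) σ τ f h : is_kernel σ τ f ->
  (forall y z, linear (fun x => G x y z)) -> (forall x z, linear (fun y => G x y z)) ->
  (forall x y, linear (fun z => G x y z)) ->
  Δ[h1, h2 <- h] ρ[a0, l <- f h2] Δ[l1, l2 <- l] G a0 l1 (τ h1 ∙ l2) =
  Δ[h1, h2 <- h] ρ[a0, l <- f h1] G a0 l (σ h2).
Proof.
move=> [fl fm] G1 G2 G3.
pose T a t := ρ[a0, l <- a] G a0 l t.
have T1 t : linear (fun a => T a t) by rewrite /T; lin.
have T2 a : linear (fun t => T a t) by rewrite /T; lin.
have /(congr1 (tfold T)) := fm h; rewrite !tfold_tfold // => e.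
etransitivity; [|etransitivity; [exact: e|]].
  apply: eq_tfold => h1 h2; rewrite tfold_tfold // -coactA; try lin.
  by apply: eq_tfold => a0 a1; rewrite tfold_pure.
by apply: eq_tfold => h1 h2; rewrite tfold_pure.
Qed.

(** The kernel of H_ρ -> H_σ ⊗ A -> (H_τ ⊗ A) ⊗ A -> H_τ ⊗ (A ⊗ A) -> H_τ ⊗ A;
    the factor ω comes from the third arrow, the associativity constraint. *)
Definition kleisli (τ : H -> H) (g f : H -> A) : H -> A := fun h =>
  sweedler 2 h (fun h1 h2 h3 => ρ[a0, a1 <- g h2] ρ[b0, b1 <- f h3]
    ω (τ h1) a1 b1 *: (a0 ⋆ b0)).

Lemma kleisli_linear τ g f : linear τ -> linear g -> linear f -> linear (kleisli τ g f).
Proof. by move=> τl gl fl; rewrite /kleisli; cbv [sweedler]; lin. Qed.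

Lemma kleisli_app (U : lmodType k) (L : A -> U) τ g f h : linear L ->
  L (kleisli τ g f h) = sweedler 2 h (fun h1 h2 h3 => ρ[a0, a1 <- g h2] ρ[b0, b1 <- f h3]
    ω (τ h1) a1 b1 *: L (a0 ⋆ b0)).
Proof. by move=> Ll; rewrite /kleisli; cbv [sweedler]; push_map Ll. Qed.

Lemma coact_kleisli (U : lmodType k) (F : A -> H -> U) τ g f h :
  linear τ -> linear g -> linear f ->
  (forall y, linear (fun x => F x y)) -> (forall x, linear (fun y => F x y)) ->
  ρ[c0, c1 <- kleisli τ g f h] F c0 c1 =
  sweedler 2 h (fun h1 h2 h3 => ρ[a0, l <- g h2] ρ[b0, m <- f h3] Δ[l1, l2 <- l] Δ[m1, m2 <- m]
    ω (τ h1) l2 m2 *: F (a0 ⋆ b0) (l1 ∙ m1)).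
Proof.
move=> τl gl fl F1 F2.
rewrite (kleisli_app (L := fun a => ρ[c0, c1 <- a] F c0 c1)); last by lin.
do 2!apply: eq_tfold => ? ?.
rewrite -(coact_coact_amul (W := fun l m c0 c1 => ω _ l m *: F c0 c1)); try lin.
by sums.
Qed.

End ComoduleAlgebra.

Section Category.
Variables (k : fieldType) (H : coquasi_Hopf k) (A : comodule_algebra H).
Implicit Types (h : H).

(** The comodule indexed by this map is trivial: h |-> h ⊗ 1. *)
Definition unit_map h : H := ε h *: 1H.

Lemma id_coalgebra_map : coalgebra_map (fun h : H => h).
Proof. by split=> // h; rewrite {1}[comul H h]tensor_reprE. Qed.

Lemma unit_coalgebra_map : coalgebra_map unit_map.
Proof.
split=> [|h|h]; first by rewrite /unit_map; lin.
- rewrite /unit_map linearZ /= (cq_one_comul (cqH_bialgebra H)).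
  transitivity (Δ[h1, h2 <- h] (ε h1 * ε h2) *: ((cq_one H) ⊗ (cq_one H))).
    by symmetry; regroup.
  by apply: eq_tfold => h1 h2; rewrite pureZl pureZr scalerA.
- by rewrite /unit_map linearZ /= counit_one mulr1.
Qed.

(** Quasi-associativity of H rebrackets τ(h)(a b) as (τ(h) a) b, after which
    colinearity of g and then that of f apply. *)
Lemma kleisli_kernel χ σ τ g f : coalgebra_map χ -> coalgebra_map σ -> coalgebra_map τ ->
  is_kernel (A := A) σ τ g -> is_kernel χ σ f -> is_kernel χ τ (kleisli τ g f).
Proof.
move=> χm σm τm gm fm.
have [χl σl τl] := And3 (map_linear χm) (map_linear σm) (map_linear τm).
have [gl fl] := conj (proj1 gm) (proj1 fm).
split; first exact: kleisli_linear.
move=> h.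
under_legs 1%N ltac:(rewrite coact_kleisli //; try lin).
transitivity (sweedler 2 h (fun x h3 h4 => ρ[a0, l <- g h3] ρ[b0, m <- f h4]
  sweedler 1 x (fun x1 x2 => sweedler 1 l (fun l1 l2 => sweedler 1 m (fun m1 m2 =>
    ω (τ x2) l2 m2 *: (a0 ⋆ b0 ⊗ (τ x1 ∙ (l1 ∙ m1)))))))).
  transitivity (sweedler 3 h (fun h1 h2 h3 h4 => ρ[a0, l <- g h3] ρ[b0, m <- f h4]
    Δ[l1, l2 <- l] Δ[m1, m2 <- m]
    ω (τ h2) l2 m2 *: (a0 ⋆ b0 ⊗ (τ h1 ∙ (l1 ∙ m1))))).
    by regroup.
  by symmetry; regroup.
transitivity (sweedler 2 h (fun x h3 h4 => ρ[a0, l <- g h3] ρ[b0, m <- f h4]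
  Δ[x1, x2 <- x] Δ[l1, l2 <- l] Δ[m1, m2 <- m]
    ω (τ x1) l1 m1 *: (a0 ⋆ b0 ⊗ (τ x2 ∙ l2 ∙ m2)))).
  apply: eq_tfold => x y; apply: eq_tfold => h3 h4.
  apply: eq_tfold => a0 l; apply: eq_tfold => b0 m.
  transitivity (Δ[t1, t2 <- τ x] Δ[l1, l2 <- l] Δ[m1, m2 <- m]
     ω t2 l2 m2 *: (a0 ⋆ b0 ⊗ (t1 ∙ (l1 ∙ m1)))).
    by rewrite (comul_map _ τm); try lin.
  rewrite (hmulA (Ψ := fun x => _ ⊗ x)); last by lin.
  by rewrite (comul_map _ τm); try lin.
transitivity (sweedler 2 h (fun h1 y h4 => Δ[h2, h3 <- y]
  ρ[a0, l <- g h3] Δ[l1, l2 <- l] ρ[b0, m <- f h4]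
  Δ[m1, m2 <- m] ω (τ h1) l1 m1 *: (a0 ⋆ b0 ⊗ (τ h2 ∙ l2 ∙ m2)))).
  transitivity (sweedler 3 h (fun h1 h2 h3 h4 =>
    ρ[a0, l <- g h3] Δ[l1, l2 <- l] ρ[b0, m <- f h4]
    Δ[m1, m2 <- m] ω (τ h1) l1 m1 *: (a0 ⋆ b0 ⊗ (τ h2 ∙ l2 ∙ m2)))).
    by regroup.
  by symmetry; regroup.
transitivity (sweedler 2 h (fun h1 y h4 => Δ[h2, h3 <- y]
  ρ[a0, l <- g h2] ρ[b0, m <- f h4]
  Δ[m1, m2 <- m] ω (τ h1) l m1 *: (a0 ⋆ b0 ⊗ (σ h3 ∙ m2)))).
  do 2!(apply: eq_tfold => ? ?).
  by rewrite (kernelE (G := fun a0 l1 t => ρ[b0, m <- f _]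
    Δ[m1, m2 <- m] ω (τ _) l1 m1 *: (a0 ⋆ b0 ⊗ (t ∙ m2))) _ gm); try lin.
transitivity (sweedler 2 h (fun h1 h2 y => Δ[h3, h4 <- y]
  ρ[b0, m <- f h4] Δ[m1, m2 <- m]  ρ[a0, l <- g h2]
  ω (τ h1) l m1 *: (a0 ⋆ b0 ⊗ (σ h3 ∙ m2)))).
  transitivity (sweedler 3 h (fun h1 h2 h3 h4 =>
    ρ[b0, m <- f h4] Δ[m1, m2 <- m]  ρ[a0, l <- g h2]
    ω (τ h1) l m1 *: (a0 ⋆ b0 ⊗ (σ h3 ∙ m2)))).
    by regroup.
  by symmetry; regroup.
transitivity (sweedler 2 h (fun h1 h2 y => Δ[h3, h4 <- y]
  ρ[b0, m <- f h3] ρ[a0, l <- g h2] ω (τ h1) l m *: (a0 ⋆ b0 ⊗ χ h4))).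
  do 2!(apply: eq_tfold => ? ?).
  by rewrite (kernelE (G := fun b0 m t => ρ[a0, l <- g _]
    ω (τ _) l m *: (a0 ⋆ b0 ⊗ t)) _ fm); try lin.
symmetry.
under_legs 1%N ltac:(rewrite (kleisli_app (L := fun a => a ⊗ _)); last lin).
transitivity (sweedler 3 h (fun h1 h2 h3 h4 =>
  ρ[b0, m <- f h3] ρ[a0, l <- g h2] ω (τ h1) l m *: (a0 ⋆ b0 ⊗ χ h4))).
  by regroup.
by symmetry; regroup.
Qed.

End Category.

Section Category.
Variables (k : fieldType) (H : coquasi_Hopf k) (A : comodule_algebra H).
Implicit Types (h : H).

(** The left-hand side has two factors ω, the right-hand side three: two from
    the compositions and one from the associator of A.  Colinearity of e puts
    the former in the shape of the cocycle identity. *)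
Lemma kleisli_assoc σ σ' τ (e g f : H -> A) h :
  coalgebra_map σ -> coalgebra_map σ' -> coalgebra_map τ ->
  is_kernel σ' τ e -> is_kernel σ σ' g -> linear f ->
  kleisli τ e (kleisli σ' g f) h = kleisli τ (kleisli τ e g) f h.
Proof.
move=> σm σm' τm em gm fl.
have [σl σl' τl] := And3 (map_linear σm) (map_linear σm') (map_linear τm).
have [el gl] := conj (proj1 em) (proj1 gm).
(* both sides reduce to this expression, which has three factors ω *)
transitivity (sweedler 4 h (fun h1 h2 h3 h4 h5 =>
  ρ[e0, n <- e h3] ρ[a0, l <- g h4] ρ[b0, m <- f h5]
    sweedler 2 n (fun n1 n2 n3 => sweedler 2 l (fun l1 l2 l3 => sweedler 1 m (fun m1 m2 =>
    (ω n1 l1 m1 * ω (τ h1) (n2 ∙ l2) m2 * ω (τ h2) n3 l3) *: (e0 ⋆ (a0 ⋆ b0))))))); last first.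
  symmetry.
  transitivity (sweedler 2 h (fun h1 y h5 => sweedler 2 y (fun h2 h3 h4 =>
    ρ[e0, n <- e h3] ρ[a0, l <- g h4] Δ[n1, n2 <- n] Δ[l1, l2 <- l] ω (τ h2) n2 l2 *:
    (ρ[b0, m <- f h5] ω (τ h1) (n1 ∙ l1) m *: (e0 ⋆ a0 ⋆ b0))))).
    do 2!(apply: eq_tfold => ? ?).
    by rewrite (coact_kleisli
      (F := fun c0 c1 => ρ[b0, m <- f _] ω _ c1 m *: (c0 ⋆ b0))) //; try lin.
  transitivity (sweedler 4 h (fun h1 h2 h3 h4 h5 =>
    ρ[e0, n <- e h3] ρ[a0, l <- g h4] ρ[b0, m <- f h5] Δ[n1, n2 <- n] Δ[l1, l2 <- l]
      (ω (τ h1) (n1 ∙ l1) m * ω (τ h2) n2 l2) *: (e0 ⋆ a0 ⋆ b0))).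
    by regroup.
  do 4!(apply: eq_tfold => ? ?).
  rewrite (coact_amul_assoc (W := fun n l m c => Δ[n1, n2 <- n] Δ[l1, l2 <- l]
    (ω _ (n1 ∙ l1) m * ω _ n2 l2) *: c)); try lin.
  by do 3!(apply: eq_tfold => ? ?); regroup.
transitivity (sweedler 1 h (fun h1 x => Δ[h2, y <- x] ρ[e0, n <- e h2]
  sweedler 2 y (fun h3 h4 h5 => ρ[a0, l <- g h4] ρ[b0, m <- f h5] Δ[l1, l2 <- l]
    Δ[m1, m2 <- m] ω (σ' h3) l2 m2 *: (ω (τ h1) n (l1 ∙ m1) *: (e0 ⋆ (a0 ⋆ b0)))))).
  do 2!(apply: eq_tfold => ? ?); apply: eq_tfold => e0 n.
  by rewrite (coact_kleisli (F := fun c0 c1 => ω _ n c1 *: (e0 ⋆ c0))) //; try lin.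
transitivity (sweedler 3 h (fun h1 y h4 h5 => Δ[h2, h3 <- y] ρ[e0, n <- e h2]
  ρ[a0, l <- g h4] ρ[b0, m <- f h5] Δ[l1, l2 <- l] Δ[m1, m2 <- m]
    (ω (τ h1) n (l1 ∙ m1) * ω (σ' h3) l2 m2) *: (e0 ⋆ (a0 ⋆ b0)))).
  transitivity (sweedler 4 h (fun h1 h2 h3 h4 h5 => ρ[e0, n <- e h2]
    ρ[a0, l <- g h4] ρ[b0, m <- f h5] Δ[l1, l2 <- l] Δ[m1, m2 <- m]
      (ω (τ h1) n (l1 ∙ m1) * ω (σ' h3) l2 m2) *: (e0 ⋆ (a0 ⋆ b0)))).
    by regroup.
  by symmetry; regroup.
transitivity (sweedler 3 h (fun h1 y h4 h5 => Δ[h2, h3 <- y] ρ[e0, n <- e h3]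
  Δ[n1, n2 <- n] ρ[a0, l <- g h4] ρ[b0, m <- f h5] Δ[l1, l2 <- l] Δ[m1, m2 <- m]
    (ω (τ h1) n1 (l1 ∙ m1) * ω (τ h2 ∙ n2) l2 m2) *: (e0 ⋆ (a0 ⋆ b0)))).
  do 3!(apply: eq_tfold => ? ?).
  by rewrite (kernelE (G := fun e0 n t => ρ[a0, l <- g _] ρ[b0, m <- f _]
    Δ[l1, l2 <- l] Δ[m1, m2 <- m]
    (ω (τ _) n (l1 ∙ m1) * ω t l2 m2) *: (e0 ⋆ (a0 ⋆ b0))) _ em); try lin.
transitivity (sweedler 3 h (fun x h3 h4 h5 => ρ[e0, n <- e h3]
  ρ[a0, l <- g h4] ρ[b0, m <- f h5] (Δ[t1, t2 <- τ x] Δ[n1, n2 <- n] Δ[l1, l2 <- l] Δ[m1, m2 <- m]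
    (ω t1 n1 (l1 ∙ m1) * ω (t2 ∙ n2) l2 m2) *: (e0 ⋆ (a0 ⋆ b0))))).
  transitivity (sweedler 4 h (fun h1 h2 h3 h4 h5 => ρ[e0, n <- e h3]
    ρ[a0, l <- g h4] ρ[b0, m <- f h5] (Δ[n1, n2 <- n] Δ[l1, l2 <- l] Δ[m1, m2 <- m]
      (ω (τ h1) n1 (l1 ∙ m1) * ω (τ h2 ∙ n2) l2 m2) *: (e0 ⋆ (a0 ⋆ b0))))).
    by regroup.
  symmetry; under_legs 6%N ltac:(rewrite (comul_map _ τm); try lin).
  by regroup.
legs 6%N cocycle.
under_legs 6%N ltac:(cbv [sweedler]; rewrite (comul_map _ τm); try lin).
by regroup.
Qed.

Lemma coact_scale_one (U : lmodType k) (F : A -> H -> U) (c : k) :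
  (forall y, linear (fun x => F x y)) -> (forall x, linear (fun y => F x y)) ->
  ρ[c0, c1 <- c *: ca_one A] F c0 c1 = c *: F 1A 1H.
Proof.
move=> F1 F2; rewrite (linear_valZ (f := fun a => ρ[c0, c1 <- a] F c0 c1)); last by lin.
by rewrite coact_one.
Qed.

Lemma kleisli_unitl τ (f : H -> A) h : coalgebra_map τ -> linear f ->
  kleisli τ (conv_one A) f h = f h.
Proof.
move=> τm fl; have τl := map_linear τm.
transitivity (sweedler 2 h (fun h1 h2 h3 => (ε h1 * ε h2) *: f h3)).
  do 2!(apply: eq_tfold => ? ?); rewrite coact_scale_one ?scaler_tfold; try lin.
  under_legs 1%N ltac:(rewrite omega1 (map_counit τm) amul1l).
  rewrite -[in RHS](coact_counit (G := fun a => a) (f _)); last by lin.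
  by sums.
by regroup.
Qed.

Lemma kleisli_unitr τ (f : H -> A) h : coalgebra_map τ -> linear f ->
  kleisli τ f (conv_one A) h = f h.
Proof.
move=> τm fl; have τl := map_linear τm.
transitivity (sweedler 2 h (fun h1 h2 h3 => (ε h1 * ε h3) *: f h2)).
  do 2!(apply: eq_tfold => ? ?).
  under_legs 1%N ltac:(rewrite coact_scale_one; try lin).
  under_legs 1%N ltac:(rewrite omega_right1 (map_counit τm) amul1r).
  rewrite -[in RHS](coact_counit (G := fun a => a) (f _)); last by lin.
  by sums.
by regroup.
Qed.

Lemma unit_kernel τ : coalgebra_map τ -> is_kernel τ τ (conv_one A).
Proof.
move=> τm; have τl := map_linear τm.
split=> [|h]; first by rewrite /conv_one; lin.
transitivity ((ca_one A) ⊗ τ h).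
  under_legs 1%N ltac:(rewrite coact_scale_one; try lin).
  by under_legs 1%N ltac:(rewrite hmul1r); regroup.
by symmetry; rewrite /conv_one; under_legs 1%N ltac:(rewrite pureZl); regroup.
Qed.

(** The associativity constraint is trivial when the outer comodule is. *)
Lemma kleisli_unit_map (g f : H -> A) h : linear g -> linear f ->
  kleisli (@unit_map k H) g f h = Δ[h1, h2 <- h] (g h1 ⋆ f h2).
Proof.
move=> gl fl; have ul := map_linear (@unit_coalgebra_map k H).
transitivity (sweedler 2 h (fun h1 h2 h3 => ε h1 *: (g h2 ⋆ f h3))); last by regroup.
apply: eq_tfold => h1 y; apply: eq_tfold => h2 h3.
transitivity (ε h1 *: (ρ[a0, a1 <- g h2] ρ[b0, b1 <- f h3] (ε a1 * ε b1) *: (a0 ⋆ b0))).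
  rewrite scaler_tfold; apply: eq_tfold => a0 a1.
  rewrite scaler_tfold; apply: eq_tfold => b0 b1.
  rewrite /unit_map (linear_valZ (f := fun x => ω x a1 b1 *: (a0 ⋆ b0))); last by lin.
  by rewrite omega_left1; leaf.
transitivity (ε h1 *: (ρ[a0, a1 <- g h2] ε a1 *: (ρ[b0, b1 <- f h3] ε b1 *: (a0 ⋆ b0)))).
  by sums.
congr (_ *: _); rewrite -(coact_counit (G := fun a => a ⋆ f h3)); last by lin.
by apply: eq_tfold => a0 a1; rewrite coact_counit; last lin.
Qed.
End Category.

(** * Transposition along the antipode *)

Section Transpose.
Variables (k : fieldType) (H : coquasi_Hopf k) (A : comodule_algebra H).
Implicit Types (h g : H).

Lemma sweedler2_antipode (U : lmodType k) (F : H -> H -> H -> U) h :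
  (forall y z, linear (fun x => F x y z)) -> (forall x z, linear (fun y => F x y z)) ->
  (forall x y, linear (fun z => F x y z)) ->
  Δ[x, t <- antipode H h] Δ[y, z <- t] F x y z =
  sweedler 2 h (fun h1 h2 h3 => F (S h3) (S h2) (S h1)).
Proof.
move=> F1 F2 F3; cbv [sweedler]; rewrite comul_antipode; try lin.
under_legs 1%N ltac:(rewrite comul_antipode; try lin).
by regroup.
Qed.

Lemma pentagon_left_antipode h g m l (U : lmodType k) (u : U) :
  sweedler 1 g (fun g1 g2 => sweedler 1 m (fun m1 m2 => sweedler 1 l (fun l1 l2 =>
     (ω' (S h) g1 (m1 ∙ l1) * ω g2 m2 l2) *: u))) =
  sweedler 2 h (fun h1 h2 h3 => sweedler 2 g (fun g1 g2 g3 =>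
    sweedler 2 m (fun m1 m2 m3 => sweedler 1 l (fun l1 l2 =>
      (ω (S h3 ∙ g1) m1 l1 * ω' (S h2) g2 m2 * ω' (S h1) (g3 ∙ m3) l2) *: u)))).
Proof.
by rewrite pentagon_left; cbv [sweedler]; rewrite sweedler2_antipode; try lin.
Qed.

(** Colinearity of q for the coaction h |-> h2 ⊗ S(h1) σ(h3), the one that
    V' ⊗ V induces on the matrix coefficients of a comodule V with dual V',
    once the coaction of the factor V is pushed forward along σ. *)
Definition is_twisted (σ : H -> H) (q : H -> A) : Prop := linear q /\ forall h,
  coact A (q h) = sweedler 2 h (fun h1 h2 h3 => q h2 ⊗ (S h1 ∙ σ h3)).

(** Precomposition with the coevaluation, whose trace on matrix coefficients is
    h1 β(h2) S(h3); the factor ω rebrackets (V ⊗ V') ⊗ V as V ⊗ (V' ⊗ V). *)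
Definition transpose (σ : H -> H) (q : H -> A) : H -> A := fun h =>
  sweedler 4 h (fun h1 h2 h3 h4 h5 => (ω h1 (S h3) (σ h5) * β h2) *: q h4).

(** The inverse passage, by the evaluation S(h1) α(h2) h3; the factor ω^-1
    rebrackets V' ⊗ (V ⊗ A) as (V' ⊗ V) ⊗ A. *)
Definition untranspose (f : H -> A) : H -> A := fun h =>
  sweedler 3 h (fun h1 h2 h3 h4 => ρ[a0, a1 <- f h4] (ω' (S h1) h3 a1 * α h2) *: a0).

Lemma twistedE (U : lmodType k) (F : A -> H -> U) σ q h (qb : is_twisted σ q) :
  (forall y, linear (fun x => F x y)) -> (forall x, linear (fun y => F x y)) ->
  ρ[a0, a1 <- q h] F a0 a1 = sweedler 2 h (fun h1 h2 h3 => F (q h2) (S h1 ∙ σ h3)).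
Proof.
move=> F1 F2; rewrite (proj2 qb); cbv [sweedler]; rewrite tfold_tfold //.
apply: eq_tfold => h1 y; rewrite tfold_tfold //.
by apply: eq_tfold => h2 h3; rewrite tfold_pure.
Qed.

Lemma transpose_linear σ q : linear σ -> linear q -> linear (transpose σ q).
Proof. by move=> σl ql; rewrite /transpose; cbv [sweedler]; lin. Qed.

Lemma untranspose_linear f : linear f -> linear (untranspose f).
Proof. by move=> fl; rewrite /untranspose; cbv [sweedler]; lin. Qed.

Lemma transpose_app (U : lmodType k) (L : A -> U) σ q h : linear L ->
  L (transpose σ q h) =
  sweedler 4 h (fun h1 h2 h3 h4 h5 => (ω h1 (S h3) (σ h5) * β h2) *: L (q h4)).
Proof. by move=> Ll; rewrite /transpose; cbv [sweedler]; push_map Ll. Qed.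

Lemma untranspose_app (U : lmodType k) (L : A -> U) f h : linear L ->
  L (untranspose f h) = sweedler 3 h (fun h1 h2 h3 h4 => ρ[a0, a1 <- f h4]
    (ω' (S h1) h3 a1 * α h2) *: L a0).
Proof. by move=> Ll; rewrite /untranspose; cbv [sweedler]; push_map Ll. Qed.

Lemma coact_transpose (U : lmodType k) (F : A -> H -> U) σ q h : linear σ -> is_twisted σ q ->
  (forall y, linear (fun x => F x y)) -> (forall x, linear (fun y => F x y)) ->
  ρ[a0, a1 <- transpose σ q h] F a0 a1 =
  sweedler 6 h (fun h1 h2 h3 h4 h5 h6 h7 =>
    (ω h1 (S h3) (σ h7) * β h2) *: F (q h5) (S h4 ∙ σ h6)).
Proof.
move=> σl qb F1 F2; have ql := proj1 qb.
rewrite (transpose_app (L := fun a => ρ[a0, a1 <- a] F a0 a1)); last by lin.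
transitivity (sweedler 4 h (fun h1 h2 h3 y h7 => (ω h1 (S h3) (σ h7) * β h2) *:
  sweedler 2 y (fun h4 h5 h6 => F (q h5) (S h4 ∙ σ h6)))).
  by do 4!(apply: eq_tfold => ? ?); rewrite (twistedE _ qb).
by regroup.
Qed.

(** Quasi-associativity brings the leg h1 next to S(h3), where the identity of β
    absorbs both and leaves σ. *)
Lemma transpose_kernel σ q : coalgebra_map σ -> is_twisted σ q ->
  is_kernel σ (fun h => h) (transpose σ q).
Proof.
move=> σm qb; have σl := map_linear σm; have ql := proj1 qb.
split=> [|h]; first exact: transpose_linear.
transitivity (sweedler 4 h (fun x h3 y h6 z =>
  Δ[x1, x2 <- x] Δ[s1, s2 <- S y] Δ[t1, t2 <- σ z]
    ω x2 s2 t2 *: (β h3 *: (q h6 ⊗ (x1 ∙ (s1 ∙ t1)))))).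
  transitivity (sweedler 7 h (fun h1 h2 h3 h4 h5 h6 h7 h8 =>
    (ω h2 (S h4) (σ h8) * β h3) *: (q h6 ⊗ (h1 ∙ (S h5 ∙ σ h7))))).
    by under_legs 1%N ltac:(rewrite coact_transpose //; try lin); regroup.
  symmetry; under_legs 5%N ltac:(rewrite comul_antipode; try lin).
  by under_legs 6%N ltac:(rewrite (comul_map _ σm); try lin); regroup.
under_legs 4%N ltac:(rewrite (hmulA (Ψ := fun v => β _ *: (q _ ⊗ v))); last lin).
under_legs 5%N ltac:(rewrite comul_antipode; try lin).
under_legs 6%N ltac:(rewrite (comul_map _ σm); try lin).
transitivity (sweedler 5 h (fun x1 w y2 h6 z1 z2 => sweedler 2 w (fun x2 h3 y1 =>
  β h3 *: (ω x1 (S y2) (σ z1) *: (q h6 ⊗ (x2 ∙ S y1 ∙ σ z2)))))).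
  transitivity (sweedler 7 h (fun x1 x2 h3 y1 y2 h6 z1 z2 =>
    (ω x1 (S y2) (σ z1) * β h3) *: (q h6 ⊗ (x2 ∙ S y1 ∙ σ z2)))).
    by regroup.
  by symmetry; regroup.
under_legs 5%N ltac:(rewrite (antipode_beta (Ψ := fun v => ω _ _ _ *: (q _ ⊗ (v ∙ σ _))));
  last lin).
under_legs 5%N ltac:(rewrite hmul1l).
symmetry; under_legs 1%N ltac:(rewrite (transpose_app (L := fun a => a ⊗ _)); last lin).
by symmetry; regroup.
Qed.

End Transpose.

Section Transpose.
Variables (k : fieldType) (H : coquasi_Hopf k) (A : comodule_algebra H).
Implicit Types (h g : H).

(** The calculation of [transpose_kernel] in reverse, with α and ω^-1 instead
    of β and ω. *)
Lemma untranspose_twisted σ (f : H -> A) : linear σ ->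
  is_kernel σ (fun h => h) f -> is_twisted σ (untranspose f).
Proof.
move=> σl fm; have fl := proj1 fm; split=> [|h]; first exact: untranspose_linear.
have coactl : linear (coact A) by move=> ? ? ?; rewrite linearP.
transitivity (sweedler 3 h (fun h1 h2 h3 h4 => ρ[a0, l <- f h4] Δ[l1, l2 <- l]
  (ω' (S h1) h3 l2 * α h2) *: (a0 ⊗ l1))).
  rewrite (untranspose_app _ _ coactl); do 3!(apply: eq_tfold => ? ?). 
  rewrite -(coactA (F := fun a0 l1 l2 => (ω' _ _ l2 * α _) *: (a0 ⊗ l1))); try lin.
  by apply: eq_tfold => a0 a1; rewrite -{1}[coact A a0]tfold_id; sums.
symmetry.
under_legs 2%N ltac:(rewrite (untranspose_app (L := fun a => a ⊗ _)); last lin).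
transitivity (sweedler 4 h (fun h1 h2 h3 h4 y => Δ[h5, h6 <- y] ρ[a0, l <- f h5]
  (ω' (S h2) h4 l * α h3) *: (a0 ⊗ (S h1 ∙ σ h6)))).
  transitivity (sweedler 5 h (fun h1 h2 h3 h4 h5 h6 => ρ[a0, l <- f h5]
    (ω' (S h2) h4 l * α h3) *: (a0 ⊗ (S h1 ∙ σ h6)))).
    by regroup.
  by symmetry; regroup.
under_legs 4%N ltac:(rewrite -(kernelE (G := fun a0 l t =>
  (ω' _ _ l * α _) *: (a0 ⊗ (S _ ∙ t))) _ fm); try lin).
transitivity (sweedler 3 h (fun x h3 y h6 => ρ[a0, l <- f h6]
  Δ[s1, s2 <- S x] Δ[y1, y2 <- y] Δ[l1, l2 <- l]
   ω' s1 y1 l1 *: (α h3 *: (a0 ⊗ (s2 ∙ (y2 ∙ l2)))))).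
  transitivity (sweedler 5 h (fun h1 h2 h3 h4 h5 h6 => ρ[a0, l <- f h6]
    Δ[l1, l2 <- l] (ω' (S h2) h4 l1 * α h3) *: (a0 ⊗ (S h1 ∙ (h5 ∙ l2))))).
    by regroup.
  by symmetry; under_legs 4%N ltac:(rewrite comul_antipode; try lin); regroup.
under_legs 4%N ltac:(rewrite [LHS](hmulA_inv (Ψ := fun v => α _ *: (_ ⊗ v)));
  [cbv [sweedler] | lin]).
under_legs 4%N ltac:(rewrite comul_antipode; try lin).
transitivity (sweedler 3 h (fun x1 w y2 h6 => ρ[a0, l <- f h6] Δ[l1, l2 <- l]
  sweedler 2 w (fun x2 h3 y1 => α h3 *: (ω' (S x1) y2 l2 *: (a0 ⊗ (S x2 ∙ y1 ∙ l1)))))).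
  transitivity (sweedler 5 h (fun x1 x2 h3 y1 y2 h6 => ρ[a0, l <- f h6] Δ[l1, l2 <- l]
    (ω' (S x1) y2 l2 * α h3) *: (a0 ⊗ (S x2 ∙ y1 ∙ l1)))).
    by regroup.
  by symmetry; regroup.
under_legs 5%N ltac:(rewrite (antipode_alpha (Ψ := fun v => ω' _ _ _ *: (_ ⊗ (v ∙ _)))); last lin).
by under_legs 5%N ltac:(rewrite hmul1l); sums.
Qed.

(** Half of a zigzag: by the pentagon, the evaluation on S(x) h1 is separated
    from the coevaluation that defines the transpose.  The element x is
    independent of h because its uses have α, respectively another map into A,
    applied to a leg between the two. *)
Lemma transpose_slide (U : lmodType k) (L : A -> U) σ q (x h : H) :
  coalgebra_map σ -> is_twisted (A := A) σ q -> linear L ->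
  sweedler 1 h (fun h1 y => ρ[a0, a1 <- transpose σ q y] ω' (S x) h1 a1 *: L a0) =
  sweedler 1 x (fun x1 x2 => sweedler 6 h (fun h1 h2 h3 h4 h5 h6 h7 =>
    (ω (S x2 ∙ h1) (S h5) (σ h7) * ω' (S x1) h2 (S h4) * β h3) *: L (q h6))).
Proof.
move=> σm qb Ll; have σl := map_linear σm; have ql := proj1 qb.
transitivity (sweedler 4 h (fun g h3 y h6 z =>
  sweedler 1 g (fun g1 g2 => sweedler 1 (S y) (fun m1 m2 => sweedler 1 (σ z) (fun l1 l2 =>
     (ω' (S x) g1 (m1 ∙ l1) * ω g2 m2 l2) *: (β h3 *: L (q h6))))))).
  transitivity (sweedler 7 h (fun h1 h2 h3 h4 h5 h6 h7 h8 =>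
    (ω' (S x) h1 (S h5 ∙ σ h7) * ω h2 (S h4) (σ h8) * β h3) *: L (q h6))).
    under_legs 1%N ltac:(rewrite
      (coact_transpose (F := fun a0 a1 => ω' _ _ a1 *: L a0) _ σl qb); try lin).
    by regroup.
  symmetry; cbv [sweedler]; under_legs 5%N ltac:(rewrite comul_antipode; try lin).
  by under_legs 6%N ltac:(rewrite (comul_map _ σm); try lin); regroup.
legs 4%N pentagon_left_antipode.
under_legs 8%N ltac:(rewrite sweedler2_antipode; try lin).
under_legs 10%N ltac:(cbv [sweedler]; rewrite (comul_map _ σm); try lin).
(* β absorbs the legs of w *)
transitivity (sweedler 2 x (fun x1 x2 x3 => sweedler 7 h (fun g1 g2 w y2 y3 h6 z1 z2 =>
  sweedler 2 w (fun g3 h3 y1 => β h3 *: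
  ((ω (S x3 ∙ g1) (S y3) (σ z1) * ω' (S x2) g2 (S y2) *
   ω' (S x1) (g3 ∙ S y1) (σ z2)) *: L (q h6)))))).
  transitivity (sweedler 2 x (fun x1 x2 x3 => sweedler 9 h (fun g1 g2 g3 h3 y1 y2 y3 h6 z1 z2 =>
    (ω (S x3 ∙ g1) (S y3) (σ z1) * ω' (S x2) g2 (S y2) *
     ω' (S x1) (g3 ∙ S y1) (σ z2) * β h3) *: L (q h6)))).
    by regroup.
  by symmetry; regroup.
under_legs 9%N ltac:(rewrite (antipode_beta (Ψ := fun v => (ω _ _ _ * ω' _ _ _ * ω' _ v _) *: L _));
  last lin).
under_legs 9%N ltac:(rewrite omega_inv_mid1 counit_antipode (map_counit σm)).
by regroup.
Qed.

(** After [transpose_slide] with x the first leg, α absorbs S(x2) h1 and what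
    remains is the second zigzag identity. *)
Lemma transposeK σ q h : coalgebra_map σ -> is_twisted (A := A) σ q ->
  untranspose (transpose σ q) h = q h.
Proof.
move=> σm qb; have σl := map_linear σm; have ql := proj1 qb.
have hl := transpose_linear σl ql.
transitivity (sweedler 2 h (fun x h2 y => α h2 *:
  (Δ[h3, h4 <- y] ρ[a0, a1 <- transpose σ q h4] ω' (S x) h3 a1 *: a0))).
  symmetry. transitivity (sweedler 3 h (fun x h2 h3 h4 => ρ[a0, a1 <- transpose σ q h4]
   (ω' (S x) h3 a1 * α h2) *: a0)); last by [].
  by regroup.
etransitivity.
  do 2!(apply: eq_tfold => ? ?); apply: (congr1 (GRing.scale _)).
  exact: (transpose_slide (L := fun a : A => a) _ _ σm qb (@linear_id _ _)).
(* α absorbs the legs of w *)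
transitivity (sweedler 6 h (fun x1 w h2 h3 h4 h5 y => Δ[h6, h7 <- y]
  sweedler 2 w (fun x2 v h1 => α v *:
  ((ω (S x2 ∙ h1) (S h5) (σ h7) * ω' (S x1) h2 (S h4) * β h3) *: q h6)))).
  transitivity (sweedler 9 h (fun x1 x2 v h1 h2 h3 h4 h5 h6 h7 =>
    (ω (S x2 ∙ h1) (S h5) (σ h7) * ω' (S x1) h2 (S h4) * β h3 * α v) *: q h6)).
    by regroup.
  by symmetry; regroup.
under_legs 7%N ltac:(rewrite (antipode_alpha (Ψ := fun v => (ω v _ _ * ω' _ _ _ * β _) *: q _));
  last lin).
under_legs 7%N ltac:(rewrite omega_left1 counit_antipode (map_counit σm)).
transitivity (sweedler 1 h (fun y h6 => sweedler 4 y (fun h1 h2 h3 h4 h5 =>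
  (ω' (S h1) h3 (S h5) * α h2 * β h4) *: q h6))).
  transitivity (sweedler 5 h (fun h1 h2 h3 h4 h5 h6 =>
    (ω' (S h1) h3 (S h5) * α h2 * β h4) *: q h6)).
    by regroup.
  by symmetry; regroup.
legs 1%N zigzag_inv.
by regroup.
Qed.

End Transpose.

Section Transpose.
Variables (k : fieldType) (H : coquasi_Hopf k) (A : comodule_algebra H).
Implicit Types (h g : H).

(** Here [pentagon_right] applies; both α and β absorb a pair of legs, and what
    remains is the first zigzag identity. *)
Lemma untransposeK σ f h : coalgebra_map σ -> is_kernel (A := A) σ (fun h => h) f ->
  transpose σ (untranspose f) h = f h.
Proof.
move=> σm fm; have σl := map_linear σm; have fl := proj1 fm.
transitivity (sweedler 6 h (fun h1 h2 h3 h4 h5 h6 y => Δ[h7, h8 <- y] ρ[a0, l <- f h7]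
  (ω h1 (S h3) (σ h8) * β h2 * ω' (S h4) h6 l * α h5) *: a0)).
  transitivity (sweedler 7 h (fun h1 h2 h3 h4 h5 h6 h7 h8 => ρ[a0, l <- f h7]
    (ω h1 (S h3) (σ h8) * β h2 * ω' (S h4) h6 l * α h5) *: a0)).
    by rewrite /transpose /untranspose; regroup.
  by symmetry; regroup.
under_legs 6%N ltac:(rewrite -(kernelE (G := fun a0 l t =>
  (ω _ _ t * β _ * ω' _ _ l * α _) *: a0) _ fm); try lin).
transitivity (sweedler 5 h (fun h1 h2 z h5 m h8 => ρ[a0, l <- f h8]
  sweedler 1 (S z) (fun g1 g2 => sweedler 1 m (fun m1 m2 => sweedler 1 l (fun l1 l2 =>
     (ω' g1 m1 l1 * ω h1 g2 (m2 ∙ l2)) *: ((β h2 * α h5) *: a0)))))).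
  transitivity (sweedler 7 h (fun h1 h2 h3 h4 h5 h6 h7 h8 => ρ[a0, l <- f h8]
    Δ[l1, l2 <- l]
    (ω h1 (S h3) (h7 ∙ l2) * β h2 * ω' (S h4) h6 l1 * α h5) *: a0)).
    by regroup.
  symmetry; under_legs 6%N ltac:(cbv [sweedler]; rewrite comul_antipode; try lin).
  by regroup.
legs 6%N pentagon_right.
under_legs 8%N ltac:(rewrite sweedler2_antipode; try lin).
(* β absorbs the legs of w, α those of v *)
transitivity (sweedler 7 h (fun x1 x2 w z2 v m2 m3 h8 => ρ[a0, l <- f h8]
  Δ[l1, l2 <- l] sweedler 2 v (fun z3 h5 m1 => α h5 *: (
    sweedler 2 w (fun x3 h2 z1 => β h2 *: (
    (ω x1 (S z3 ∙ m1) l1 * ω x2 (S z2) m2 * ω' (x3 ∙ S z1) m3 l2) *: a0)))))).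
  transitivity (sweedler 11 h (fun x1 x2 x3 h2 z1 z2 z3 h5 m1 m2 m3 h8 => ρ[a0, l <- f h8]
    Δ[l1, l2 <- l] (ω x1 (S z3 ∙ m1) l1 * ω x2 (S z2) m2 * ω' (x3 ∙ S z1) m3 l2 *
      β h2 * α h5) *: a0)).
    by regroup.
  by symmetry; regroup.
under_legs 11%N ltac:(rewrite (antipode_beta
  (Ψ := fun v => (ω _ _ _ * ω _ _ _ * ω' v _ _) *: _)); last lin).
under_legs 11%N ltac:(rewrite omega_inv_left1).
under_legs 9%N ltac:(rewrite (antipode_alpha
  (Ψ := fun v => β _ *: ((ω _ v _ * ω _ _ _ * _) *: _))); last lin).
under_legs 9%N ltac:(rewrite omega1).
transitivity (sweedler 7 h (fun x1 x2 w z2 v m2 m3 h8 =>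
  (ε x1 * ε m3 * (ω x2 (S z2) m2 * β w * α v)) *: f h8)).
  do 7!(apply: eq_tfold => ? ?).
  rewrite -[in RHS](coact_counit (G := fun a => a) (f _)); last by lin.
  by rewrite scaler_tfold; apply: eq_tfold => a0 l; regroup.
transitivity (sweedler 1 h (fun y h6 => sweedler 4 y (fun h1 h2 h3 h4 h5 =>
  (ω h1 (S h3) h5 * β h2 * α h4) *: f h6))).
  transitivity (sweedler 5 h (fun h1 h2 h3 h4 h5 h6 =>
    (ω h1 (S h3) h5 * β h2 * α h4) *: f h6)).
    by regroup.
  by symmetry; regroup.
legs 1%N zigzag.
by regroup.
Qed.

(** Untransposing a composite untransposes the outer factor only, with an ω^-1
    from the rebracketing of S(h1) ⊗ (τ(h3) ⊗ T).  All products and actions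
    with values in a twisted space come from this formula. *)
Lemma untranspose_kleisli τ (F T : H -> A) h :
  coalgebra_map τ -> is_kernel τ (fun h => h) F -> linear T ->
  untranspose (kleisli (fun h => h) F T) h =
  sweedler 3 h (fun h1 h2 h3 h4 => ρ[b0, m <- T h4] ω' (S h1) (τ h3) m *: (untranspose F h2 ⋆ b0)).
Proof.
move=> τm Fm Tl; have τl := map_linear τm; have Fl := proj1 Fm.
have idl := @linear_id k H.
transitivity (sweedler 4 h (fun h1 h2 g h5 h6 => ρ[a0, l <- F h5] ρ[b0, m <- T h6]
  sweedler 1 g (fun g1 g2 => sweedler 1 l (fun l1 l2 => sweedler 1 m (fun m1 m2 =>
    (ω' (S h1) g1 (l1 ∙ m1) * ω g2 l2 m2) *: (α h2 *: (a0 ⋆ b0))))))).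
  transitivity (sweedler 5 h (fun h1 h2 h3 h4 h5 h6 => ρ[a0, l <- F h5] ρ[b0, m <- T h6]
    Δ[l1, l2 <- l] Δ[m1, m2 <- m]
    (ω' (S h1) h3 (l1 ∙ m1) * ω h4 l2 m2 * α h2) *: (a0 ⋆ b0))).
    rewrite /untranspose; under_legs 3%N ltac:(rewrite (coact_kleisli
      (F := fun c0 c1 => (ω' _ _ c1 * α _) *: c0)) //; try lin).
    by regroup.
  by symmetry; regroup.
legs 6%N pentagon_left_antipode.
(* α absorbs the legs of w *)
transitivity (sweedler 6 h (fun x1 x2 w g2 g3 h5 h6 => ρ[a0, l <- F h5] ρ[b0, m <- T h6]
  sweedler 2 l (fun l1 l2 l3 => sweedler 1 m (fun m1 m2 => sweedler 2 w (fun x3 h2 g1 =>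
    α h2 *: ((ω (S x3 ∙ g1) l1 m1 * ω' (S x2) g2 l2 * ω' (S x1) (g3 ∙ l3) m2) *: (a0 ⋆ b0))))))).
  transitivity (sweedler 8 h (fun x1 x2 x3 h2 g1 g2 g3 h5 h6 =>
    ρ[a0, l <- F h5] ρ[b0, m <- T h6]
    sweedler 2 l (fun l1 l2 l3 => sweedler 1 m (fun m1 m2 =>
    (ω (S x3 ∙ g1) l1 m1 * ω' (S x2) g2 l2 * ω' (S x1) (g3 ∙ l3) m2 * α h2) *: (a0 ⋆ b0))))).
    by regroup.
  by symmetry; regroup.
under_legs 11%N ltac:(rewrite (antipode_alpha
  (Ψ := fun v => (ω v _ _ * ω' _ _ _ * ω' _ _ _) *: _)); last lin).
under_legs 11%N ltac:(rewrite omega_left1).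
transitivity (sweedler 5 h (fun x1 x2 w g2 y h6 => Δ[g3, h5 <- y]
  ρ[a0, l <- F h5] Δ[l1, l2 <- l] ρ[b0, m <- T h6]
    (α w * ω' (S x2) g2 l1 * ω' (S x1) (g3 ∙ l2) m) *: (a0 ⋆ b0))).
  transitivity (sweedler 6 h (fun x1 x2 w g2 g3 h5 h6 =>
    ρ[a0, l <- F h5] ρ[b0, m <- T h6] Δ[l1, l2 <- l]
      (α w * ω' (S x2) g2 l1 * ω' (S x1) (g3 ∙ l2) m) *: (a0 ⋆ b0))).
    by do 8!(apply: eq_tfold => ? ?); regroup.
  by symmetry; regroup.
under_legs 5%N ltac:(rewrite (kernelE (G := fun a0 l t => ρ[b0, m <- T _]
  (α _ * ω' _ _ l * ω' _ t m) *: (a0 ⋆ b0)) _ Fm); try lin).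
transitivity (sweedler 6 h (fun x1 x2 w g2 h4 h5 h6 =>
  ρ[a0, l <- F h4] ρ[b0, m <- T h6]
    (α w * ω' (S x2) g2 l * ω' (S x1) (τ h5) m) *: (a0 ⋆ b0))).
  by regroup.
symmetry; under_legs 4%N ltac:(rewrite (untranspose_app (L := fun a => a ⋆ _)); last lin).
by regroup.
Qed.

(** For τ trivial the remaining ω^-1 has 1 in the middle. *)
Lemma untranspose_kleisli_unit_map (F T : H -> A) h :
  is_kernel (@unit_map k H) (fun h => h) F -> linear T ->
  untranspose (kleisli (fun h => h) F T) h = Δ[h1, h2 <- h] (untranspose F h1 ⋆ T h2).
Proof.
move=> Fm Tl; have Fl := untranspose_linear (proj1 Fm).
rewrite (untranspose_kleisli _ (@unit_coalgebra_map k H)) //.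
transitivity (sweedler 3 h (fun h1 h2 h3 h4 =>
  (ε h1 * ε h3) *: (untranspose F h2 ⋆ T h4))); last by regroup.
do 3!(apply: eq_tfold => ? ?).
rewrite -[in RHS](coact_counit (G := fun a => _ ⋆ a) (T _)); last by lin.
rewrite scaler_tfold; apply: eq_tfold => b0 m; rewrite /unit_map.
rewrite (linear_valZ (f := fun x => ω' _ x m *: (_ ⋆ b0))); last by lin.
by rewrite omega_inv_mid1 counit_antipode; leaf.
Qed.

(** For T itself a transpose, [transpose_slide] with x the first leg expands
    the remaining ω^-1 into the three factors of the products of the context. *)
Lemma untranspose_kleisli_transpose σ s t h : coalgebra_map σ ->
  is_twisted (A := A) (fun h => h) s -> is_twisted (A := A) σ t ->
  untranspose (kleisli (fun h => h) (transpose (fun h => h) s) (transpose σ t)) h =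
  sweedler 9 h (fun h1 h2 h3 h4 h5 h6 h7 h8 h9 h10 =>
    (ω (S h2 ∙ h4) (S h8) (σ h10) * β h6 * ω' (S h1) h5 (S h7)) *: (s h3 ⋆ t h9)).
Proof.
move=> σm sb tb; have idm := @id_coalgebra_map k H.
have [sl tl] := conj (proj1 sb) (proj1 tb).
have σl := map_linear σm; have htl := transpose_linear σl tl.
rewrite (untranspose_kleisli _ idm) //; last exact: transpose_kernel.
transitivity (sweedler 2 h (fun h1 h2 y => sweedler 1 y (fun h3 h4 =>
  ρ[b0, m <- transpose σ t h4] ω' (S h1) h3 m *: (s h2 ⋆ b0)))).
  do 3!(apply: eq_tfold => ? ?); apply: eq_tfold => b0 m.
  by rewrite transposeK.
etransitivity.
  do 2!(apply: eq_tfold => ? ?).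
  by apply: (transpose_slide (L := fun a => _ ⋆ a) _ _ σm tb); lin.
by regroup.
Qed.
End Transpose.

(** * The full subcategory on the trivial and the regular comodule *)

Section Morita.
Variables (k : fieldType) (H : coquasi_Hopf k) (A : comodule_algebra H).
Implicit Types (h g : H).

Lemma omega_inv_right1 h g : ω' h g (cq_one H) = ε h * ε g.
Proof.
apply: eq_scalars => U u; have := omegaV h g (cq_one H) u.
rewrite counit_one mulr1 => <-.
transitivity (Δ[h1, h2 <- h] Δ[g1, g2 <- g] (ε h1 * ε g1 * ω' h2 g2 1H) *: u).
  by symmetry; regroup.
do 2!(apply: eq_tfold => ? ?); rewrite comul_one; try lin.
by rewrite omega_right1.
Qed.

Lemma untranspose_unit : untranspose (conv_one A) = bar_one A.
Proof.
apply: funext => h.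
transitivity (sweedler 3 h (fun h1 h2 h3 h4 => (ε h1 * ε h3 * ε h4 * α h2) *: ca_one A)).
  do 3!(apply: eq_tfold => ? ?); rewrite coact_scale_one; try lin.
  by rewrite omega_inv_right1 counit_antipode; leaf.
by rewrite /bar_one; regroup.
Qed.

Lemma transpose_unit_map (q : H -> A) h : linear q ->
  transpose (@unit_map k H) q h = Δ[h1, h2 <- h] β h1 *: q h2.
Proof.
move=> ql.
transitivity (sweedler 4 h (fun h1 h2 h3 h4 h5 => (ε h1 * ε h3 * ε h5 * β h2) *: q h4)).
  do 4!(apply: eq_tfold => ? ?); rewrite /unit_map.
  rewrite (linear_valZ (f := fun x => (ω _ _ x * β _) *: q _)); last by lin.
  by rewrite omega_right1 counit_antipode; leaf.
by regroup.
Qed.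

(** The two objects: [true] is the regular comodule, [false] the trivial one. *)
Definition grade (o : bool) : H -> H := if o then fun h => h else @unit_map k H.

Lemma grade_map o : coalgebra_map (grade o).
Proof. by case: o; [exact: id_coalgebra_map | exact: unit_coalgebra_map]. Qed.

(** Maps from i to j, presented as in the context: by their kernel when the
    target is trivial, by a twisted map when it is regular. *)
Definition homspace (i j : bool) : set (H -> A) :=
  if j then is_twisted (grade i) else is_kernel (grade i) (grade false).

Definition to_kernel i j (q : H -> A) := if j : bool then transpose (grade i) q else q.
Definition of_kernel j (f : H -> A) := if j : bool then untranspose f else f.

Definition hom_comp i j l (x y : H -> A) : H -> A :=
  of_kernel l (kleisli (grade l) (to_kernel j l x) (to_kernel i j y)).

Lemma to_kernel_mem i j q : homspace i j q -> is_kernel (grade i) (grade j) (to_kernel i j q).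
Proof. by case: j => // qb; apply: transpose_kernel => //; exact: grade_map. Qed.

Lemma of_kernel_mem i j f : is_kernel (grade i) (grade j) f -> homspace i j (of_kernel j f).
Proof.
by case: j => // fm; apply: untranspose_twisted => //; exact: (map_linear (grade_map i)).
Qed.

Lemma to_kernelK i j q : homspace i j q -> of_kernel j (to_kernel i j q) = q.
Proof. by case: j => // qb; apply: funext => h; apply: transposeK => //; exact: grade_map. Qed.

Lemma of_kernelK i j f : is_kernel (grade i) (grade j) f -> to_kernel i j (of_kernel j f) = f.
Proof. by case: j => // fm; apply: funext => h; apply: untransposeK => //; exact: grade_map. Qed.

Lemma kleisli_to_kernel i j l x y : homspace j l x -> homspace i j y ->
  is_kernel (grade i) (grade l) (kleisli (grade l) (to_kernel j l x) (to_kernel i j y)).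
Proof.
move=> /to_kernel_mem xm /to_kernel_mem ym.
by apply: kleisli_kernel xm ym; exact: grade_map.
Qed.

Lemma hom_comp_mem i j l x y :
  homspace j l x -> homspace i j y -> homspace i l (hom_comp i j l x y).
Proof. by move=> xm ym; apply: of_kernel_mem; exact: kleisli_to_kernel. Qed.

Lemma hom_comp_assoc i j l n x y z : homspace l n x -> homspace j l y -> homspace i j z ->
  hom_comp i l n x (hom_comp i j l y z) = hom_comp i j n (hom_comp j l n x y) z.
Proof.
move=> xm ym zm; rewrite /hom_comp !of_kernelK; try exact: kleisli_to_kernel.
congr (of_kernel _ _); apply: funext => h.
apply: (kleisli_assoc _ (grade_map j) (grade_map l) (grade_map n)).
- exact: to_kernel_mem.
- exact: to_kernel_mem.
- by case: (to_kernel_mem zm).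
Qed.

Definition hom_one j := of_kernel j (conv_one A).

Lemma hom_one_mem j : homspace j j (hom_one j).
Proof. by apply: of_kernel_mem; apply: unit_kernel; exact: grade_map. Qed.

Lemma hom_comp1l i j x : homspace i j x -> hom_comp i j j (hom_one j) x = x.
Proof.
move=> xm; have um : is_kernel (grade j) (grade j) (conv_one A).
  by apply: unit_kernel; exact: grade_map.
rewrite /hom_comp of_kernelK // -[RHS](to_kernelK xm); congr (of_kernel _ _); apply: funext => h.
by rewrite kleisli_unitl //; [exact: grade_map | case: (to_kernel_mem xm)].
Qed.

Lemma hom_comp1r i j x : homspace i j x -> hom_comp i i j x (hom_one i) = x.
Proof.
move=> xm; have um : is_kernel (grade i) (grade i) (conv_one A).
  by apply: unit_kernel; exact: grade_map.
rewrite /hom_comp of_kernelK // -[RHS](to_kernelK xm); congr (of_kernel _ _); apply: funext => h.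
by rewrite kleisli_unitr //; [exact: grade_map | case: (to_kernel_mem xm)].
Qed.

End Morita.
Arguments homspace {k H} A i j _.
Arguments hom_one {k H} A j _.

Section Morita.
Variables (k : fieldType) (H : coquasi_Hopf k) (A : comodule_algebra H).
Implicit Types (h g : H).

Lemma linear_transpose σ : linear (transpose (A := A) σ : (H -> A) -> (H -> A)).
Proof. by apply: linear_fun => h; rewrite /transpose; cbv [sweedler]; lin. Qed.

Lemma linear_untranspose : linear (@untranspose k H A : (H -> A) -> (H -> A)).
Proof. by apply: linear_fun => h; rewrite /untranspose; cbv [sweedler]; lin. Qed.

Lemma linear_kleislil τ (f : H -> A) : linear (fun g : H -> A => kleisli τ g f).
Proof. by apply: linear_fun => h; rewrite /kleisli; cbv [sweedler]; lin. Qed.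

Lemma linear_kleislir τ (g : H -> A) : linear (fun f : H -> A => kleisli τ g f).
Proof. by apply: linear_fun => h; rewrite /kleisli; cbv [sweedler]; lin. Qed.

Lemma linear_of_kernel j : linear (of_kernel j : (H -> A) -> (H -> A)).
Proof. by case: j; [exact: linear_untranspose | ]. Qed.

Lemma linear_to_kernel i j : linear (to_kernel i j : (H -> A) -> (H -> A)).
Proof. by case: j; [exact: linear_transpose | ]. Qed.

Lemma linear_hom_compl i j l (y : H -> A) : linear (fun x : H -> A => hom_comp i j l x y).
Proof.
apply: linear_comp (linear_of_kernel l) _.
exact: linear_comp (linear_kleislil (grade l) _) (linear_to_kernel j l).
Qed.

Lemma linear_hom_compr i j l (x : H -> A) : linear (fun y : H -> A => hom_comp i j l x y).
Proof.
apply: linear_comp (linear_of_kernel l) _.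
exact: linear_comp (linear_kleislir (grade l) _) (linear_to_kernel i j).
Qed.

Lemma subspace_linear (V W : lmodType k) : subspace (fun f : V -> W => linear f).
Proof.
split=> [a x y|a f f' fl fl' b x y]; first by rewrite scaler0 addr0.
rewrite -[LHS]/(a *: f (b *: x + y) + f' (b *: x + y)).
rewrite -[RHS]/(b *: (a *: f x + f' x) + (a *: f y + f' y)) fl fl'.
by rewrite !scalerDr !scalerA [b * a]mulrC addrACA.
Qed.

(** Both colinearity conditions equate two functions that are linear in f. *)
Lemma subspace_equalizer (V W : lmodType k) (D : set V) (T : Type) (F G : T -> V -> W) :
  subspace D -> (forall t, linear (F t)) -> (forall t, linear (G t)) ->
  subspace (fun x => D x /\ forall t, F t x = G t x).
Proof.
move=> [D0 Dl] Fl Gl; split=> [|a x y [Dx ex] [Dy ey]]; split=> //.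
- by move=> t; rewrite (linear_val0 (Fl t)) (linear_val0 (Gl t)).
- exact: Dl.
- by move=> t; rewrite Fl Gl ex ey.
Qed.

Lemma subspace_kernel σ τ : subspace (is_kernel (A := A) σ τ : set (H -> A)).
Proof. by apply: subspace_equalizer; [exact: subspace_linear | move=> h; lin ..]. Qed.

Lemma subspace_twisted σ : subspace (is_twisted (A := A) σ : set (H -> A)).
Proof.
by apply: subspace_equalizer; [exact: subspace_linear | move=> h; cbv [sweedler]; lin ..].
Qed.

Lemma subspace_hom i j : subspace (homspace A i j).
Proof. by case: j; [exact: subspace_twisted | exact: subspace_kernel]. Qed.

(** Operations are compared with composition on the subspaces only, as they are
    not constrained elsewhere. *)
Definition presents i j l (op : (H -> A) -> (H -> A) -> (H -> A)) : Prop :=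
  forall x y, homspace A j l x -> homspace A i j y -> op x y = hom_comp i j l x y.

Lemma presents_mem i j l op x y : presents i j l op -> homspace A j l x -> homspace A i j y ->
  homspace A i l (op x y).
Proof. by move=> o xm ym; rewrite o //; exact: hom_comp_mem. Qed.

Lemma presents_bilinear i j l op : presents i j l op ->
  bilinear_on (homspace A j l) (homspace A i j) (homspace A i l) op.
Proof.
move=> o; have [_ sl] := subspace_hom j l; have [_ si] := subspace_hom i j.
split=> [x y|a x x' y xm xm' ym|a x y y' xm ym ym']; first exact: presents_mem.
- by rewrite !o //; [exact: linear_hom_compl | exact: sl].
- by rewrite !o //; [exact: linear_hom_compr | exact: si].
Qed.

Lemma presents_assoc i j l n op1 op2 op3 op4 x y z :
  presents i l n op1 -> presents i j l op2 -> presents i j n op3 -> presents j l n op4 ->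
  homspace A l n x -> homspace A j l y -> homspace A i j z -> op1 x (op2 y z) = op3 (op4 x y) z.
Proof.
move=> o1 o2 o3 o4 xm ym zm.
have ozm := presents_mem o2 ym zm; have oxm := presents_mem o4 xm ym.
by rewrite o1 // o3 // o2 // o4 // hom_comp_assoc.
Qed.

Lemma presents_1l i j op x : presents i j j op -> homspace A i j x -> op (hom_one A j) x = x.
Proof. by move=> o xm; rewrite o //; [exact: hom_comp1l | exact: hom_one_mem]. Qed.

Lemma presents_1r i j op x : presents i i j op -> homspace A i j x -> op x (hom_one A i) = x.
Proof. by move=> o xm; rewrite o //; [exact: hom_comp1r | exact: hom_one_mem]. Qed.

End Morita.

(** * The operations of the context as compositions *)

Section Operations.
Variables (k : fieldType) (H : coquasi_Hopf k) (A : comodule_algebra H).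
Implicit Types (h g : H).

Lemma omega_unit_map3 x y h : ω x y (@unit_map k H h) = ε x * ε y * ε h.
Proof.
apply: eq_scalars => U u; rewrite /unit_map.
rewrite (linear_valZ (f := fun z => ω x y z *: u)); last by lin.
by rewrite omega_right1; leaf.
Qed.

Lemma hom_linear i j q : homspace A i j q -> linear q.
Proof. by case: j => -[]. Qed.

Lemma Hom_barE : Hom_bar A = homspace A true true.
Proof. by []. Qed.

(** With a trivial target, the leg h1 in the colinearity condition contributes
    a counit. *)
Lemma kernel_unit_mapE σ (p : H -> A) : is_kernel σ (@unit_map k H) p <->
  linear p /\ forall h, coact A (p h) = Δ[h1, h2 <- h] (p h1 ⊗ σ h2).
Proof.
have E h : linear p ->
    Δ[h1, h2 <- h] ρ[a0, a1 <- p h2] (a0 ⊗ (unit_map h1 ∙ a1)) = coact A (p h).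
  move=> pl; rewrite -[RHS]tfold_id.
  transitivity (Δ[h1, h2 <- h] ε h1 *: (ρ[a0, a1 <- p h2] (a0 ⊗ a1))); last by regroup.
  apply: eq_tfold => h1 h2; rewrite scaler_tfold; apply: eq_tfold => a0 a1.
  rewrite /unit_map (linear_valZ (f := fun x => a0 ⊗ (x ∙ a1))); last by lin.
  by rewrite hmul1l.
by split=> -[pl pm]; split=> // h; [rewrite -E // pm | rewrite E // pm].
Qed.

Lemma Hom_HE : Hom_H A = homspace A true false.
Proof.
apply: funext => p; apply: propext.
by split=> [[pl pm]|/kernel_unit_mapE[pl pm]]; [apply/kernel_unit_mapE|]; split.
Qed.

Lemma Hom_coinvE : Hom_coinv A = homspace A false false.
Proof.
apply: funext => r; apply: propext.
have E h : linear r -> Δ[h1, h2 <- h] (r h1 ⊗ @unit_map k H h2) = r h ⊗ 1H.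
  move=> rl; rewrite /unit_map; under_legs 1%N ltac:(rewrite pureZr).
  by regroup.
split=> [[rl rm]|/kernel_unit_mapE[rl rm]]; [apply/kernel_unit_mapE|]; split=> // h.
  by rewrite E //; exact: rm.
by rewrite /coinvariants /= rm E.
Qed.

Lemma Hom_HSE : Hom_HS A = homspace A false true.
Proof.
apply: funext => q; apply: propext.
have E h : linear q ->
    sweedler 2 h (fun h1 h2 h3 => q h2 ⊗ (S h1 ∙ @unit_map k H h3)) =
    sweedler 1 h (fun h1 h2 => q h2 ⊗ S h1).
  move=> ql; transitivity (sweedler 2 h (fun h1 h2 h3 => ε h3 *: (q h2 ⊗ S h1))).
    do 2!(apply: eq_tfold => ? ?); rewrite /unit_map.
    rewrite (linear_valZ (f := fun x => q _ ⊗ (S _ ∙ x))); last by lin.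
    by rewrite hmul1r.
  by regroup.
by split=> -[ql qm]; split=> // h; [rewrite qm -E | rewrite qm E].
Qed.

Lemma bar_mul_presents : presents true true true (bar_mul A).
Proof.
move=> s t sm tm; apply: funext => h.
by rewrite /hom_comp /= untranspose_kleisli_transpose //; exact: (grade_map H true).
Qed.

Lemma lact_HS_presents : presents false true true (lact_HS A).
Proof.
move=> s q sm qm; apply: funext => h; have [sl ql] := conj (hom_linear sm) (hom_linear qm).
rewrite /hom_comp /= untranspose_kleisli_transpose //; last exact: (grade_map H false).
symmetry; under_legs 9%N ltac:(rewrite omega_unit_map3 counit_hmul !counit_antipode).
by rewrite /lact_HS; regroup.
Qed.

Lemma pairing_qp_presents : presents true false true (pairing_qp A).
Proof.
move=> q p qm pm; apply: funext => h; have [ql pl] := conj (hom_linear qm) (hom_linear pm).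
rewrite /hom_comp /= untranspose_kleisli_unit_map //; last exact: (to_kernel_mem qm).
by apply: eq_tfold => h1 h2; rewrite transposeK //; exact: (grade_map H false).
Qed.

Lemma ract_HS_presents : presents false false true (ract_HS A).
Proof.
move=> q r qm rm; apply: funext => h; have [ql rl] := conj (hom_linear qm) (hom_linear rm).
rewrite /hom_comp /= untranspose_kleisli_unit_map //; last exact: (to_kernel_mem qm).
by apply: eq_tfold => h1 h2; rewrite transposeK //; exact: (grade_map H false).
Qed.

Lemma conv_mul_presents : presents false false false (conv_mul A).
Proof.
move=> r r' rm rm'; apply: funext => h; have [rl rl'] := conj (hom_linear rm) (hom_linear rm').
by rewrite /hom_comp /= kleisli_unit_map.
Qed.

Lemma lact_H_presents : presents true false false (lact_H A).
Proof.
move=> r p rm pm; apply: funext => h; have [rl pl] := conj (hom_linear rm) (hom_linear pm).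
by rewrite /hom_comp /= kleisli_unit_map.
Qed.

Lemma ract_H_presents : presents true true false (ract_H A).
Proof.
move=> p s pm sm; apply: funext => h; have [pl sl] := conj (hom_linear pm) (hom_linear sm).
rewrite /hom_comp /= kleisli_unit_map //; last exact: transpose_linear.
symmetry; under_legs 1%N ltac:(rewrite (transpose_app (L := fun a => _ ⋆ a)); last lin).
by rewrite /ract_H; regroup.
Qed.

Lemma pairing_pq_presents : presents false true false (pairing_pq A).
Proof.
move=> p q pm qm; apply: funext => h; have [pl ql] := conj (hom_linear pm) (hom_linear qm).
have hl : linear (transpose (@unit_map k H) q).
  by apply: transpose_linear ql; exact: (map_linear (grade_map H false)).
rewrite /hom_comp /= kleisli_unit_map //.
apply: eq_tfold => h1 y; rewrite transpose_unit_map //.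
rewrite (tfold_map _ _ (L := fun a => p h1 ⋆ a)); last by lin.
by apply: eq_tfold => h2 h3; rewrite (linear_valZ (f := fun a => p h1 ⋆ a)) //; lin.
Qed.

End Operations.

Theorem proposition29 (k : fieldType) (H : coquasi_Hopf k)
    (A : comodule_algebra H) :
  is_morita_context
    (Hom_bar A) (bar_mul A) (bar_one A)
    (Hom_coinv A) (conv_mul A) (conv_one A)
    (Hom_H A) (lact_H A) (ract_H A)
    (Hom_HS A) (lact_HS A) (ract_HS A)
    (pairing_pq A) (pairing_qp A).
Proof.
have rr := @bar_mul_presents k H A; have tt := @conv_mul_presents k H A.
have tp := @lact_H_presents k H A; have pr := @ract_H_presents k H A.
have rq := @lact_HS_presents k H A; have qt := @ract_HS_presents k H A.
have pq := @pairing_pq_presents k H A; have qp := @pairing_qp_presents k H A.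
rewrite Hom_barE Hom_HE Hom_coinvE Hom_HSE -untranspose_unit.
rewrite -[untranspose _]/(hom_one A true) -[conv_one A]/(hom_one A false).
split.
- split; [exact: subspace_hom | exact: presents_bilinear | exact: hom_one_mem | | | ].
  + by move=> x y z xm ym zm; apply: (presents_assoc rr rr rr rr).
  + by move=> x xm; apply: (presents_1l rr).
  + by move=> x xm; apply: (presents_1r rr).
- split; [exact: subspace_hom | exact: presents_bilinear | exact: hom_one_mem | | | ].
  + by move=> x y z xm ym zm; apply: (presents_assoc tt tt tt tt).
  + by move=> x xm; apply: (presents_1l tt).
  + by move=> x xm; apply: (presents_1r tt).
- split; [exact: subspace_hom | exact: presents_bilinear | exact: presents_bilinear | | | | | ].
  + by move=> x y m xm ym mm; apply: (presents_assoc tp tp tp tt).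
  + by move=> m mm; apply: (presents_1l tp).
  + by move=> m x y mm xm ym; symmetry; apply: (presents_assoc pr rr pr pr).
  + by move=> m mm; apply: (presents_1r pr).
  + by move=> x m y xm mm ym; symmetry; apply: (presents_assoc tp pr pr tp).
- split; [exact: subspace_hom | exact: presents_bilinear | exact: presents_bilinear | | | | | ].
  + by move=> x y m xm ym mm; apply: (presents_assoc rq rq rq rr).
  + by move=> m mm; apply: (presents_1l rq).
  + by move=> m x y mm xm ym; symmetry; apply: (presents_assoc qt tt qt qt).
  + by move=> m mm; apply: (presents_1r qt).
  + by move=> x m y xm mm ym; symmetry; apply: (presents_assoc rq qt qt rq).
- split; first exact: presents_bilinear.
  + by move=> m x n mm xm nm; symmetry; apply: (presents_assoc pq rq pq pr).
  + by move=> x m n xm mm nm; symmetry; apply: (presents_assoc tt pq pq tp).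
  + by move=> m n x mm nm xm; apply: (presents_assoc pq qt tt pq).
- split; first exact: presents_bilinear.
  + by move=> m x n mm xm nm; symmetry; apply: (presents_assoc qp tp qp qt).
  + by move=> x m n xm mm nm; symmetry; apply: (presents_assoc rr qp qp rq).
  + by move=> m n x mm nm xm; apply: (presents_assoc qp pr rr qp).
- by move=> p q p' pm qm pm'; symmetry; apply: (presents_assoc pr qp tp pq).
- by move=> q p q' qm pm qm'; symmetry; apply: (presents_assoc qt pq rq qp).
Qed.
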